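(* The following bounds hold: \begin{align*} r_3(n) &\leq \alpha(n)^{(4+o(1))n}, \\ r_4(n) &\leq 2^{n \cdot \left(2 \alpha(n) + 3 \log_2(\alpha(n)) + O(1) \right)}, \\ r_{2t+2}(n) &\leq 2^{n \cdot ((2/t!)\alpha(n)^t + O(\alpha(n)^{t-1}) )} \qquad \text{for every fixed integer } t \geq 2, \text{ and} \\ r_{2t+3}(n) &\leq 2^{n \cdot ((2/t!)\alpha(n)^t \log_2(\alpha(n)) + O(\alpha(n)^t)) } \qquad \text{for every fixed integer } t \geq 1. \end{align*}
   Context: Write $[n]=\{1,\dots,n\}$. An $n$-permutation is a permutation of $[n]$. For $1\le a_1<a_2<\dots<a_k\le n$, the restriction of an $n$-permutation $\pi$ to the $k$-tuple of positions $(a_1,\dots,a_k)$ is the $k$-permutation $\pi'$ satisfying $\pi'(i)<\pi'(j)\Leftrightarrow \pi(a_i)<\pi(a_j)$ for all $i,j$. A $k$-tuple of positions is shattered by a set $\mathcal P$ of $n$-permutations if each $k$-permutation appears as the restriction of some $\pi\in\mathcal P$ to that $k$-tuple. The VC-dimension of $\mathcal P$ is the size of the largest set of positions shattered by $\mathcal P$. $r_k(n)$ denotes the size of the largest set of $n$-permutations with VC-dimension $k$. Inverse Ackermann function: $\alpha_1(m)=\lceil m/2\rceil$; $\alpha_d(1)=0$ for $d\ge 2$; $\alpha_d(m)=1+\alpha_d(\alpha_{d-1}(m))$ for $m,d\ge 2$; and $\alpha(m)=\min\{k\ge 1:\alpha_k(m)\le 3\}$. Asymptotic notation is for $n\to\infty$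 (so the bounds are for all sufficiently large $n$), with implied constants depending only on $t$ where $t$ occurs. *)

(* Defs.v *)
From mathcomp Require Import all_boot all_algebra perm zify.
From mathcomp Require Import reals exp.
Set Implicit Arguments.
Unset Strict Implicit.
Unset Printing Implicit Defensive.

Local Open Scope nat_scope.

(* Positions and values are numbered from 0; only their order matters. *)

Definition is_restriction (n k : nat) (p : 'S_n) (a : k.-tuple 'I_n)
    (q : 'S_k) : bool :=
  [forall i : 'I_k, forall j : 'I_k,
    (q i < q j) == (p (tnth a i) < p (tnth a j))].

Definition increasing (n k : nat) (a : k.-tuple 'I_n) : bool :=
  sorted ltn [seq val i | i <- a].

Definition shatters (n k : nat) (P : {set 'S_n}) (a : k.-tuple 'I_n) : bool :=
  [forall q : 'S_k, exists p in P, is_restriction p a q].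

(* The empty family shatters nothing, not even the empty tuple; the empty
   maximum assigns it the value 0. *)
Definition VCdim (n : nat) (P : {set 'S_n}) : nat :=
  \max_(k < n.+1 | [exists a : k.-tuple 'I_n, increasing a && shatters P a]) k.

(* The value is 0 when no set of n-permutations has VC-dimension k, as for
   n < k. *)
Definition r_vc (k n : nat) : nat := \max_(P : {set 'S_n} | VCdim P == k) #|P|.

(* The number of applications of f that bring m down to at most 1, cut off at
   the given fuel; fuel m is enough as soon as f x < x for all x > 1. *)
Fixpoint descend (f : nat -> nat) (fuel m : nat) : nat :=
  if fuel is fuel'.+1 then
    if m <= 1 then 0 else (descend f fuel' (f m)).+1
  else 0.

(* The inverse Ackermann hierarchy starts at index 1: index 0 is not used.
   The lemmas alphad_1m, alphad_d1 and alphad_rec are its defining equations. *)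
Fixpoint alphad (d m : nat) : nat :=
  if d is d'.+1 then
    if d' is 0 then uphalf m else descend (alphad d') m m
  else m.

Lemma descend_fuel (f : nat -> nat) :
  (forall x, 1 < x -> f x < x) ->
  forall k l m, m <= k -> m <= l -> descend f k m = descend f l m.
Proof.
move=> fx; elim=> [|k IH] [|l] m //=.
- by rewrite leqn0 => /eqP ->.
- by rewrite leqn0 => _ /eqP ->.
move=> mk ml; case: (leqP _ 1) => // m1; congr _.+1.
by apply: IH; rewrite -ltnS; apply: leq_trans (fx _ m1) _.
Qed.

Lemma alphad_1m (m : nat) : alphad 1 m = uphalf m.
Proof. by []. Qed.

Lemma alphad_d1 (d : nat) : 1 < d -> alphad d 1 = 0.
Proof. by case: d => [|[]]. Qed.

Lemma alphad_le (d m : nat) : alphad d.+1 m <= uphalf m.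
Proof.
elim: d m => [|d IH] m //.
suff H k : forall m, descend (alphad d.+1) k m <= uphalf m by apply: H.
move: (alphad d.+1) IH => f fle; elim: k => [|k IHk] x //=.
case: (leqP _ 1) => // x1; have fx := fle x; have fk := IHk (f x).
have [x2|x2] := ltnP 2 x; first by lia.
have -> : descend f k (f x) = 0.
  have : f x <= 1 by lia.
  by case: k {IHk fk} => [|k] /= ?; rewrite // ifT.
by lia.
Qed.

Lemma alphad_rec (d m : nat) :
  1 < m -> 1 < d -> alphad d m = (alphad d (alphad d.-1 m)).+1.
Proof.
case: d => [|[|d]] // m1 _.
have lt x : 1 < x -> alphad d.+1 x < x by have := alphad_le d x; lia.
rewrite -pred_Sn ![alphad d.+2 _]/(descend (alphad d.+1) _ _).
move: (alphad d.+1) lt => f lt; have ltm := lt _ m1.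
case: m m1 ltm => // m m1 ltm; rewrite [LHS]/= leqNgt m1 /=.
by congr _.+1; apply: descend_fuel.
Qed.

Lemma alphad_small (m : nat) : exists k, (0 < k) && (alphad k m <= 3).
Proof.
suff H d : exists k, (0 < k) && (alphad k m <= maxn 3 (uphalf m - d)).
  by have [k] := H (uphalf m); rewrite subnn maxn0; exists k.
elim: d => [|d [k /andP[k0 IH]]].
  by exists 1; rewrite alphad_1m; lia.
have [le3|gt3] := leqP (alphad k m) 3; first by exists k; rewrite k0; lia.
have m1 : 1 < m by case: k k0 IH gt3 => // k _ _; have := alphad_le k m; lia.
exists k.+1; rewrite alphad_rec // -pred_Sn; have := alphad_le k (alphad k m); lia.
Qed.

Definition alpha (m : nat) : nat := ex_minn (alphad_small m).

Definition log2 (R : realType) (x : R) : R := (ln x / ln 2)%R.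

(* Main.v *)
(* A permutation p is encoded by the cuts (i, c) with c < p i, and a family P by
   its traces on a set D of cuts. P has |P| traces on the set of all cuts, and at
   most (2X)^n traces on D if |D| <= n * X. Group the n values into rows. By a
   recursion along the inverse Ackermann hierarchy, in the style of Nivasch's
   bounds for formation-avoiding sequences, if D has many cuts then there are s
   disjoint intervals of rows and r columns each having many cuts in each of these
   intervals. If p crosses the value interval phi(i) at each column i of a set of s
   columns, for a bijection phi, then its restriction to these columns is phi; so
   if no s columns are shattered, then few sets of columns realize all choices of
   intervals, and, as in Pajor's lemma, a large part of the traces do not cross some
   interval t(i), for at least half of the r columns i. All cuts of these columns in
   that interval except the first are then redundant and are removed. For r = 2^c
   this costs a factor 2^O(c^2) in the number of traces. Removing cuts in this way,
   in phases that halve |D|, down to |D| = n * P * Q up to lower order factors, where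
   P and Q bound the contributions of a column and of a row in the recursion, gives
   |P| <= 2^(n (log P + log Q + lower order)). *)

Require Import Defs.
From mathcomp Require Import all_boot perm zify.
Set Implicit Arguments.
Unset Strict Implicit.
Unset Printing Implicit Defensive.

(** * Avoiding one letter per column *)

(** Bernoulli's inequality [(1 + 1/x)^k >= 1 + k/x] without denominators; the next lemma is its
    counterpart for [(1 - 1/b)^k]. *)
Lemma bernoulli_expn x k : x ^ k * (x + k) <= x * x.+1 ^ k.
Proof.
elim: k => [|k IH]; first by rewrite !expn0 addn0 mul1n muln1.
rewrite !expnS; move: (x ^ k) (x.+1 ^ k) IH => X Y; nia.
Qed.

Lemma bernoulli_expn_pred b k : 0 < b -> k <= b -> b ^ k * (b - k) <= b * b.-1 ^ k.
Proof.
move=> b0; elim: k => [|k IH] kb; first by rewrite !expn0 subn0 mul1n muln1.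
have := IH (ltnW kb); rewrite !expnS; move: (b ^ k) (b.-1 ^ k) => X Y h.
have : X * (b - k) * b.-1 <= b * Y * b.-1 by rewrite leq_mul2r h orbT.
have : b * X * (b - k.+1) <= X * (b - k) * b.-1 by rewrite -mulnA [b * (X * _)]mulnCA -mulnA leq_mul2l;
  apply/orP; right; nia.
by nia.
Qed.

Lemma expn_double_self s : 1 < s -> 2 * s.-1 ^ s <= s ^ s.
Proof.
case: s => [|[|x]] // _; have := bernoulli_expn x.+1 x.+2.
by rewrite -pred_Sn; move: (x.+2 ^ _) => Y; rewrite expnS; move: (x.+1 ^ _) => X; nia.
Qed.

Section Letters.
Variables (T I : finType) (s : nat) (u : T -> I -> 'I_s -> bool).
Implicit Types (G : {set T}) (K L : {set I}).

(** Later [u g i a] means that the trace [g] crosses the interval [a] in the column [i]. The choice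
    [phi] is total on [I] for convenience; only its values on [L] count. *)
Definition realizes G L : bool :=
  [forall phi : {ffun I -> 'I_s}, exists g in G, forall i in L, u g i (phi i)].

Definition realized G K : {set {set I}} := [set L in powerset K | realizes G L].

Lemma realizesP G L :
  reflect (forall phi : {ffun I -> 'I_s},
             exists2 g, g \in G & forall i, i \in L -> u g i (phi i))
          (realizes G L).
Proof.
apply: (iffP forallP) => H phi; have := H phi.
  by case/exists_inP=> g gG /forall_inP gL; exists g.
by case=> g gG gL; apply/exists_inP; exists g => //; apply/forall_inP.
Qed.

Lemma realizesW G G' L L' :
  G \subset G' -> L' \subset L -> realizes G L -> realizes G' L'.
Proof.
move=> /subsetP sG /subsetP sL /realizesP H; apply/realizesP => phi.
by have [g /sG gG gL] := H phi; exists g => // i /sL; apply: gL.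
Qed.

Lemma realized_sub G G' K K' :
  G \subset G' -> K \subset K' -> #|realized G K| <= #|realized G' K'|.
Proof.
move=> sG sK; apply/subset_leq_card/subsetP => L.
rewrite !inE => /andP[LK /(realizesW sG (subxx L)) ->].
by rewrite (subset_trans LK).
Qed.

Definition users G i a := [set g in G | u g i a].

Lemma realizesU1 G L i : (0 < s)%N ->
  (forall a, realizes (users G i a) L) -> realizes G (i |: L).
Proof.
move=> s0 H; apply/realizesP => phi.
have [g + gL] := realizesP _ _ (H (phi i)) phi.
by rewrite inE => /andP[gG gi]; exists g => // j /setU1P[->|/gL].
Qed.

(* A set realized by every [users G i a] stays realized when [i] is added, so it
   is counted twice on the right; any other one misses a letter. *)
Lemma realized_split G K i : 1 < s -> i \in K ->
  exists a, s * #|realized (users G i a) (K :\ i)| <= s.-1 * #|realized G K|.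
Proof.
move=> s1 iK; have s0 : 0 < s by apply: leq_trans s1.
pose F a := realized (users G i a) (K :\ i).
pose S := powerset (K :\ i).
have Fsum : \sum_a #|F a| <= s.-1 * #|realized G K|.
  have cardF a : #|F a| = \sum_(L in S) (L \in F a).
    rewrite -sum1_card big_mkcond /= [RHS]big_mkcond /=; apply: eq_bigr => L _.
    by rewrite !inE; case: (L \subset _); case: (realizes _ _).
  have step L : L \in S -> \sum_a (L \in F a) <=
      s.-1 * (L \in realized G K) + ((i |: L) \in realized G K).
    rewrite inE => LS.
    have LK : L \subset K by apply: subset_trans LS (subsetDl _ _).
    have iLK : (i |: L) \subset K by rewrite subUset sub1set iK.
    have Fa a : (L \in F a) = realizes (users G i a) L by rewrite !inE LS.
    have sub a : L \in F a -> L \in realized G K.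
      rewrite Fa inE powersetE LK => /realizesW -> //.
      by apply/subsetP => g; rewrite inE => /andP[].
    have [/forallP allF | /forallPn[a naF]] := boolP [forall a, L \in F a].
      have -> : i |: L \in realized G K.
        by rewrite !inE iLK realizesU1 // => a; rewrite -Fa.
      rewrite (sub (Ordinal s0)) // (eq_bigr (fun=> 1)); last by move=> a _; rewrite allF.
      by rewrite sum1_card card_ord; lia.
    rewrite (bigD1 a) //= (negbTE naF) add0n.
    have [LG|LG] := boolP (L \in realized G K).
      apply: leq_trans (leq_addr _ _); rewrite muln1.
      apply: leq_trans (_ : \sum_(b | b != a) 1 <= _).
        by apply: leq_sum => b _; case: (_ \in _).
      by rewrite sum1_card cardC1 card_ord.
    rewrite big1 // => b _; case: (boolP (L \in F b)) => // /sub.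
    by rewrite (negbTE LG).
  rewrite (eq_bigr _ (fun a _ => cardF a)) exchange_big /=.
  apply: (leq_trans (leq_sum _ step)).
  rewrite big_split /= -big_distrr /=.
  have cnt (f : {set I} -> {set I}) : {in S &, injective f} ->
      \sum_(L in S) (f L \in realized G K) = #|[set f L | L in S] :&: realized G K|.
    move=> fI; have <- := big_imset (fun X => nat_of_bool (X \in realized G K)) fI.
    rewrite -sum1_card big_mkcond [RHS]big_mkcond /=; apply: eq_bigr => X _.
    by rewrite in_setI; case: ifP => //= _; case: (X \in _).
  have fI : {in S &, injective (fun L => i |: L)}.
    move=> A B; rewrite !inE => /subsetD1P[_ iA] /subsetD1P[_ iB] eqAB.
    by rewrite -(setU1K iA) -(setU1K iB) eqAB.
  have := cnt id (in2W (fun _ _ => id)); rewrite imset_id => ->; rewrite (cnt _ fI).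
  set X := _ :&: _; set Y := _ :&: _.
  have dXY : [disjoint X & Y].
    rewrite -setI_eq0; apply/eqP/setP => L; rewrite !inE; apply/negbTE.
    apply/negP => /andP[/andP[/subsetD1P[_ iL] _] /andP[/imsetP[A _ eL] _]].
    by rewrite eL setU11 in iL.
  have XY : #|X| + #|Y| <= #|realized G K|.
    rewrite -cardsUI (disjoint_setI0 dXY) cards0 addn0.
    by apply: subset_leq_card; rewrite subUset !subsetIr.
  apply: leq_trans (leq_mul (leqnn s.-1) XY); rewrite mulnDr leq_add2l.
  by rewrite leq_pmull // -ltnS prednK.
apply/existsP; rewrite -[X in is_true X]negbK negb_exists; apply/negP => /forallP H.
have : \sum_(a < s) (s.-1 * #|realized G K|).+1 <= \sum_(a < s) s * #|F a|.
  by apply: leq_sum => a _; have := H a; rewrite -ltnNge.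
rewrite sum_nat_const card_ord -big_distrr /= leq_pmul2l //.
by rewrite ltnNge Fsum.
Qed.

Definition avoids G K (t : I -> 'I_s) :=
  forall g i, g \in G -> i \in K -> ~~ u g i (t i).

(* A column one of whose letters is used by at most a fraction [1 / beta] of [G]
   avoids that letter at a small loss; any other column is given up, and [G] is
   cut down to the users of the letter provided by [realized_split]. *)
Lemma avoiding_subfamily beta G K : 1 < s -> 1 < beta -> G != set0 ->
  exists K0 t G', [/\ K0 \subset K, G' \subset G, avoids G' K0 t,
    s ^ #|K :\: K0| <= s.-1 ^ #|K :\: K0| * #|realized G K| &
    #|G| * beta.-1 ^ #|K0| <= beta ^ (#|K0| + #|K :\: K0|) * #|G'|].
Proof.
move=> s1 b1; have s0 : 0 < s by apply: leq_trans s1.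
move cK : #|K| => k; elim: k K G cK => [|k IH] K G cK G0.
  move/eqP: cK; rewrite cards_eq0 => /eqP ->.
  exists set0, (fun=> Ordinal s0), G; split=> //; first by move=> g i _; rewrite inE.
    rewrite set0D cards0 !expn0 mul1n card_gt0; apply/set0Pn; exists set0.
    rewrite !inE subxx; apply/realizesP => phi.
    by case/set0Pn: G0 => g gG; exists g => // i; rewrite inE.
  by rewrite set0D !cards0 muln1 mul1n.
have [i iK] : exists i, i \in K by apply/set0Pn; rewrite -card_gt0 cK.
have cKi : #|K :\ i| = k by move: cK; rewrite (cardsD1 i) iK => -[].
have [/existsP[a ha]|/existsPn ha] := boolP [exists a, beta * #|users G i a| <= #|G|].
  pose G1 := G :\: users G i a.
  have cG1 : #|G1| + #|users G i a| = #|G|.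
    rewrite -(cardsID (users G i a) G) addnC; congr (_ + _).
    by apply: eq_card => g; rewrite !inE; case: (g \in G).
  have G10 : G1 != set0 by rewrite -card_gt0; move: G0; rewrite -card_gt0; nia.
  have [K0 [t [G' [sK sG av h1 h2]]]] := IH _ _ cKi G10.
  have iK0 : i \notin K0 by apply: contraTN isT => /(subsetP sK); rewrite !inE eqxx.
  have eD : K :\: (i |: K0) = (K :\ i) :\: K0 by rewrite setDDl.
  exists (i |: K0), (fun j => if j == i then a else t j), G'; split=> //.
  - by rewrite subUset sub1set iK (subset_trans sK) // subsetDl.
  - by apply: subset_trans sG _; apply: subsetDl.
  - move=> g j gG' /setU1P[->|jK0]; first rewrite eqxx.
      by have := subsetP sG _ gG'; rewrite !inE => /andP[+ gG]; rewrite gG.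
    by case: eqP => [e|_]; [rewrite e (negbTE iK0) in jK0 | apply: av].
  - rewrite eD; apply: leq_trans h1 _; rewrite leq_mul2l realized_sub ?orbT //.
      exact: subsetDl.
    exact: subsetDl.
  rewrite eD cardsU1 iK0 add1n expnS addSn expnS.
  have : #|G| * beta.-1 <= beta * #|G1| by nia.
  move: (beta.-1 ^ _) (beta ^ _) h2 => X Y h2 h3.
  by have := leq_mul h3 (leqnn X); have := leq_mul (leqnn beta) h2; nia.
have [a ha'] := realized_split G s1 iK.
have := ha a; rewrite -ltnNge => {}ha.
have G10 : users G i a != set0 by rewrite -card_gt0; nia.
have [K0 [t [G' [sK sG av h1 h2]]]] := IH _ _ cKi G10.
have iK0 : i \notin K0 by apply: contraTN isT => /(subsetP sK); rewrite !inE eqxx.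
have cD : #|K :\: K0| = #|(K :\ i) :\: K0|.+1.
  rewrite (cardsD1 i) !inE iK0 iK add1n; congr _.+1; apply: eq_card => j.
  by rewrite !inE; case: (j \in K0); rewrite //= andbF.
exists K0, t, G'; split=> //.
- by apply: subset_trans sK (subsetDl _ _).
- by apply: subset_trans sG _; apply/subsetP => g; rewrite inE => /andP[].
- rewrite cD !expnS; move: (s ^ _) (s.-1 ^ _) h1 => X Y h1; nia.
rewrite cD addnS expnS; move: (beta ^ _) (beta.-1 ^ _) h2 => X Y h2.
by have := leq_mul (ltnW ha) (leqnn Y); have := leq_mul (leqnn beta) h2; nia.
Qed.

(** Subsets of realized sets are realized, so a realized set has fewer than [s] columns, and [K] has
    at most [|K|^j] subsets of [j] columns. *)
Lemma card_realized G K : 1 < #|K| ->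
  (forall L, L \subset K -> #|L| = s -> ~~ realizes G L) ->
  #|realized G K| <= #|K| ^ s.
Proof.
move=> K1 noL.
have small L : L \in realized G K -> #|L| < s.
  rewrite !inE => /andP[LK rL]; rewrite ltnNge; apply/negP => sL.
  have : 0 < #|[set A : {set I} | (A \subset L) & #|A| == s]|.
    by rewrite cards_draws bin_gt0.
  rewrite card_gt0 => /set0Pn[A]; rewrite inE => /andP[AL /eqP cA].
  have /negP := noL A (subset_trans AL LK) cA; apply.
  exact: realizesW (subxx _) AL rL.
apply: leq_trans (_ : \sum_(j < s) #|K| ^ j <= _).
  apply: leq_trans (_ : \sum_(j < s) #|[set A : {set I} | (A \subset K) & #|A| == j]| <= _).
    rewrite -sum1_card [X in _ <= X](eq_bigr (fun j : 'I_s =>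
      \sum_(L in realized G K | #|L| == j) 1 + #|[set A : {set I} | (A \subset K) & #|A| == j]
        :\: realized G K|)); last first.
      move=> j _; rewrite sum1dep_card addnC -[LHS](cardsID (realized G K)) addnC; congr (_ + _).
      apply: eq_card => L; rewrite [LHS]inE [X in X && _]inE [RHS]inE !inE.
      by case: (L \subset K); rewrite ?andbF // /= andbC.
    rewrite big_split /=; apply: leq_trans (leq_addr _ _).
    rewrite (eq_bigr (fun j : 'I_s => \sum_(L in realized G K) (#|L| == j))); last first.
      by move=> j _; rewrite -big_mkcondr.
    rewrite exchange_big /=; apply: leq_sum => L /small Ls.
    by rewrite (bigD1 (Ordinal Ls)) //= eqxx.
  apply: leq_sum => j _; rewrite cards_draws.
  apply: (@leq_trans (#|K| ^_ j)).
    by rewrite -bin_ffact leq_pmulr // fact_gt0.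
  rewrite -[_ ^ j]muln1 ffact_prod -[X in _ ^ X](card_ord j) -prod_nat_const muln1.
  by apply: leq_prod => i _; apply: leq_subr.
elim: s => [|s' IH]; first by rewrite big_ord0.
rewrite big_ord_recr /= expnS; move: IH; move: (\sum_(i < s') _) (#|K| ^ s') => X Y; nia.
Qed.

(** By [expn_double_self], every [s] factors [s / s.-1] gain at least a factor 2, so a larger [w]
    would exceed [2 ^ (c * s)]. *)
Lemma expn_ratio_bound w c : 1 < s -> s ^ w <= s.-1 ^ w * 2 ^ (c * s) ->
  w <= s * (c * s + 1).
Proof.
move=> s1 h; rewrite leqNgt; apply/negP => /ltnW lt.
have : 2 ^ (c * s + 1) * s.-1 ^ (s * (c * s + 1)) <= s ^ (s * (c * s + 1)).
  by rewrite !expnM -expnMn leq_exp2r ?addn1 // expn_double_self.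
rewrite addn1 expnSr; move: lt h; rewrite addn1; move: (s * _) => W lt.
rewrite -(subnK lt); move: (w - W) => d; rewrite !expnD.
have : s.-1 ^ d <= s ^ d by case: d => // d; rewrite leq_exp2r // leq_pred.
have : 0 < s.-1 ^ W by rewrite expn_gt0; case: s s1 => [|[]].
have : 0 < s ^ d by rewrite expn_gt0 (leq_trans _ s1).
have : 0 < 2 ^ (c * s) by rewrite expn_gt0.
move: (s.-1 ^ d) (s ^ d) (s.-1 ^ W) (s ^ W) (2 ^ (c * s)) => a b A B D D0 b0 A0 ab h1 h2.
have : D * 2 * A * b <= a * A * D.
  have h3 := leq_mul (leqnn b) h2; apply: leq_trans h1.
  by apply: leq_trans h3; rewrite mulnC.
have : a * A * D <= b * A * D by rewrite -!mulnA leq_mul2r ab orbT.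
have : 0 < D * A * b by rewrite !muln_gt0 D0 A0.
by nia.
Qed.

Lemma avoiding_subfamily_pow2 c G K (W := s * (c * s + 1)) :
  1 < s -> #|K| = 2 ^ c -> 2 * W <= 2 ^ c -> G != set0 ->
  (forall L, L \subset K -> #|L| = s -> ~~ realizes G L) ->
  exists K0 t G', [/\ K0 \subset K, G' \subset G, avoids G' K0 t,
    2 ^ c <= 2 * #|K0| & #|G| <= 2 ^ (c.+1 * W).+1 * #|G'|].
Proof.
move=> s1 cK hW G0 noL.
have c0 : 0 < c by rewrite /W in hW; case: (c) hW => //; rewrite expn0; nia.
have K1 : 1 < #|K| by rewrite cK -{1}(expn0 2) ltn_exp2l.
have b1 : 1 < 2 ^ c.+1 by rewrite -{1}(expn0 2) ltn_exp2l.
(* Here [beta] is [2 ^ c.+1], twice the number of columns: by Bernoulli's inequality all avoiding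
   columns together cost only a factor 2, while each column given up costs a factor [beta]. *)
have [K0 [t [G' [sK sG av h1 h2]]]] := avoiding_subfamily K s1 b1 G0.
have cKK : #|K0| + #|K :\: K0| = 2 ^ c.
  by rewrite -cK -(cardsID K0 K) (setIidPr sK).
have wW : #|K :\: K0| <= W.
  apply: expn_ratio_bound => //; apply: leq_trans h1 _.
  by rewrite leq_mul2l expnM -cK card_realized ?orbT.
exists K0, t, G'; split=> //; first by lia.
have hb : (2 ^ c.+1) ^ #|K0| <= 2 * (2 ^ c.+1).-1 ^ #|K0|.
  have kb : #|K0| <= 2 ^ c by lia.
  have := @bernoulli_expn_pred (2 ^ c.+1) #|K0| (ltnW b1).
  rewrite expnS; set X := _ ^ #|K0|; set Y := _ ^ #|K0| => /(_ _).
  have := expn_gt0 2 c; nia.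
have Y0 : 0 < (2 ^ c.+1).-1 ^ #|K0| by rewrite expn_gt0 -ltnS prednK ?b1 // ltnW.
rewrite -(leq_pmul2r Y0); apply: leq_trans h2 _.
rewrite expnD mulnAC; apply: leq_trans (leq_mul (leq_mul hb (leqnn _)) (leqnn _)) _.
rewrite [2 ^ (_ * W).+1]expnS expnM;
  have : (2 ^ c.+1) ^ #|K :\: K0| <= (2 ^ c.+1) ^ W by rewrite leq_exp2l.
move: ((2 ^ c.+1).-1 ^ #|K0|) ((2 ^ c.+1) ^ #|K :\: K0|) ((2 ^ c.+1) ^ W) => x y z yz.
by rewrite -!mulnA leq_mul2l /= mulnCA [z * _]mulnCA leq_mul2l [z * _]mulnC leq_mul2l yz !orbT.
Qed.

End Letters.

(** * Weights and fat formations *)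

Section Weights.
Variables (I : finType) (B r : nat).
Implicit Types (a : I -> nat -> nat) (C : {set I}) (s L P Q : nat).

Definition weight a i p q := \sum_(p <= y < q) a i y.

(* [ys] lists the ends of [s] consecutive row intervals, the first of which
   starts at [y0]; rows outside of them are allowed. *)
Definition formation s a C := exists y0 ys, size ys = s /\
  r <= #|[set i in C | path (fun p q => B <= weight a i p q) y0 ys]|.

(* The columns in [C] are only required to have little weight outside of the rows
   from [lo] to [hi]: with this slack, columns confined to a group of rows are
   passed to that group without any loss. *)
Definition weight_bound s m L P Q := forall a C M lo hi,
  (forall i y, a i y <= L) -> (forall i y, M <= y -> a i y = 0) ->
  lo <= hi <= M -> hi - lo <= m ->
  (forall i, i \in C -> weight a i 0 lo < B) ->
  (forall i, i \in C -> weight a i hi M < B) ->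
  ~ formation s a C ->
  \sum_(i in C) weight a i 0 M <= P * #|C| + r * Q * (hi - lo).

Lemma weight_cat a i p q t : p <= q <= t ->
  weight a i p t = weight a i p q + weight a i q t.
Proof. by case/andP=> pq qt; rewrite /weight (big_cat_nat pq qt). Qed.

Lemma weight_nil a i p q : q <= p -> weight a i p q = 0.
Proof. by move=> qp; rewrite /weight big_geq. Qed.

Lemma weight_sub a i p q p' q' : p' <= p -> q <= q' ->
  weight a i p q <= weight a i p' q'.
Proof.
move=> pp qq; have [qp|pq] := leqP q p; first by rewrite weight_nil.
rewrite (@weight_cat a i p' p q') ?pp ?(leq_trans (ltnW pq)) //.
by rewrite (@weight_cat a i p q q') ?(ltnW pq) // addnCA leq_addr.
Qed.

Lemma weight_leM a i p q L : (forall y, a i y <= L) -> weight a i p q <= L * (q - p).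
Proof.
move=> aL; rewrite mulnC -sum_nat_const_nat; exact: leq_sum.
Qed.

Lemma weight_ltn a i p q : 0 < weight a i p q -> p < q.
Proof. by case: (ltnP p q) => // qp; rewrite weight_nil. Qed.

Lemma weight_local a i L M lo hi : (forall y, a i y <= L) -> lo <= hi <= M ->
  weight a i 0 lo < B -> weight a i hi M < B -> weight a i 0 M <= 2 * B + L * (hi - lo).
Proof.
move=> aL /andP[lh hM] h1 h2; rewrite (@weight_cat a i 0 lo) ?(leq_trans lh) //.
rewrite (@weight_cat a i lo hi) ?lh //; have := weight_leM lo hi aL; lia.
Qed.

(** A column weighs less than [2 * B] outside of the rows from [lo] to [hi] and at most [L] in each
    of these. This starts the recursion, both for a single row and for a bounded number of
    groups. *)
Lemma weight_bound_trivial s m L : weight_bound s m L (2 * B + L * m) 0.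
Proof.
move=> a C M lo hi aL _ lhM hm h1 h2 _; rewrite muln0 addn0 mulnC -sum_nat_const.
apply: leq_sum => i iC; apply: leq_trans (weight_local (aL i) lhM (h1 i iC) (h2 i iC)) _.
by rewrite leq_add2l leq_mul2l hm orbT.
Qed.

Lemma weight_boundW s m L P Q m' L' P' Q' : m' <= m -> L' <= L -> P <= P' -> Q <= Q' ->
  weight_bound s m L P Q -> weight_bound s m' L' P' Q'.
Proof.
move=> mm LL PP QQ H a C M lo hi aL a0 lhM hm h1 h2 nF.
apply: leq_trans (H a C M lo hi _ a0 lhM _ h1 h2 nF) _.
- by move=> i y; apply: leq_trans (aL i y) LL.
- exact: leq_trans hm mm.
by rewrite leq_add // leq_mul // leq_mul.
Qed.

(** Fewer than [r] columns weigh [B] or more, as these make a formation with one interval; their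
    weight is charged to the rows. *)
Lemma weight_bound1 m L : weight_bound 1 m L (2 * B) L.
Proof.
move=> a C M lo hi aL a0 lhM hm h1 h2 nF.
pose C1 := [set i in C | B <= weight a i 0 M].
have C1r : #|C1| < r.
  rewrite ltnNge; apply/negP => rC; apply: nF; exists 0, [:: M]; split=> //.
  by apply: leq_trans rC _; apply: subset_leq_card; apply/subsetP => i; rewrite !inE /= andbT.
apply: (@leq_trans (\sum_(i in C) (2 * B + (i \in C1) * (L * (hi - lo))))).
  apply: leq_sum => i iC; rewrite inE iC /=; have [_|lt] := leqP B; last first.
    by apply: leq_trans (leq_addr _ _); rewrite (leq_trans (ltnW lt)) // leq_pmull.
  by rewrite mul1n (weight_local (aL i) lhM) // ?h1 ?h2.
rewrite big_split /= sum_nat_const mulnC leq_add2l -big_distrl /= -mulnA leq_mul2r;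
  apply/orP; right.
rewrite -big_mkcondr /= sum1dep_card; apply: leq_trans (ltnW C1r).
by apply: subset_leq_card; apply/subsetP => i; rewrite inE => /andP[].
Qed.

(** A boundary [y] splits fewer than [r] columns into two parts of weight at least [B]. The rows at
    which a given column is not split contribute at most [2 * B + L] to it. *)
Lemma weight_bound2 m L : weight_bound 2 m L (2 * B + L) L.
Proof.
move=> a C M lo hi aL a0 /andP[lh hM] hm h1 h2 nF.
pose splits i y := (B <= weight a i 0 y) && (B <= weight a i y M).
have splitr y : #|[set i in C | splits i y]| < r.
  rewrite ltnNge; apply/negP => rC; apply: nF; exists 0, [:: y; M]; split=> //.
  by apply: leq_trans rC _; apply: subset_leq_card; apply/subsetP => i; rewrite !inE /= andbT.
have one i : i \in C -> weight a i 0 M <= 2 * B + L + L * \sum_(lo <= y < hi) splits i y.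
  move=> iC; have [lt|ge] := ltnP (weight a i 0 M) B; first by lia.
  (* Before [z1], for the first time, the column weighs at least [B]; [z2] is the first boundary
     from [z1] on after which it weighs less. All rows from [z1] up to [z2] split the column. *)
  have ex1 : exists y, B <= weight a i 0 y by exists M.
  case: (ex_minnP ex1) => z1 z1B z1min.
  have z1M : z1 <= M by apply: z1min.
  have wz1 : weight a i 0 z1 < B + L.
    case: z1 z1min {z1B z1M} => [|z] zmin; first by rewrite weight_nil //; have := h1 i iC; lia.
    have lt : weight a i 0 z < B by rewrite ltnNge; apply/negP => /zmin; rewrite ltnn.
    by rewrite /weight big_nat_recr //= -addSn leq_add.
  have ex2 : exists y, (z1 <= y) && (weight a i y M < B).
    by exists M; rewrite z1M weight_nil //; have := h1 i iC; lia.
  case: (ex_minnP ex2) => z2 /andP[z12 z2B] z2min.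
  have z2M : z2 <= M by apply: z2min; rewrite z1M weight_nil //; have := h1 i iC; lia.
  rewrite (@weight_cat a i 0 z1) ?z1M // (@weight_cat a i z1 z2) ?z12 //.
  have sp y : z1 <= y < z2 -> [&& lo <= y, y < hi & splits i y].
    case/andP=> zy yz; have By : B <= weight a i 0 y.
      by apply: leq_trans z1B _; apply: weight_sub.
    have yB : B <= weight a i y M.
      by rewrite leqNgt; apply/negP => lt; have := z2min y; rewrite zy lt => /(_ isT); lia.
    rewrite /splits By yB !andbT; apply/andP; split.
      rewrite leqNgt; apply/negP => lt; have := @weight_sub a i 0 y 0 lo (leqnn _) (ltnW lt).
      by have := h1 i iC; lia.
    rewrite ltnNge; apply/negP => le; have := @weight_sub a i y M hi M le (leqnn _).
    by have := h2 i iC; lia.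
  have : z2 - z1 <= \sum_(lo <= y < hi) splits i y.
    have [->|lt] := eqVneq z1 z2; first by rewrite subnn.
    have {}lt : z1 < z2 by rewrite ltn_neqAle lt.
    have /and3P[loz1 _ _] : [&& lo <= z1, z1 < hi & splits i z1] by apply: sp; lia.
    have /and3P[_ z2hi _] : [&& lo <= z2.-1, z2.-1 < hi & splits i z2.-1] by apply: sp; lia.
    rewrite (@big_cat_nat _ _ _ z1) //=; last by lia.
    rewrite (@big_cat_nat _ _ _ z2 z1) //=; last by lia.
    rewrite addnCA -[X in X <= _]addn0 leq_add //.
    rewrite -[z2 - z1]muln1 -sum_nat_const_nat big_nat [X in _ <= X]big_nat.
    by apply: leq_sum => y yz; have /and3P[_ _ ->] := sp y yz.
  have := weight_leM z1 z2 (aL i); move: (\sum_(_ <= _ < _) _) => S le1 le2.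
  have : L * (z2 - z1) <= L * S by rewrite leq_mul2l le2 orbT.
  lia.
apply: leq_trans (leq_sum _ one) _.
rewrite big_split /= sum_nat_const mulnC leq_add2l -big_distrr /= [r * L]mulnC -mulnA leq_mul2l.
apply/orP; right; rewrite exchange_big /= mulnC -sum_nat_const_nat; apply: leq_sum => y _.
by rewrite -big_mkcondr /= sum1dep_card ltnW // (leq_ltn_trans _ (splitr y)).
Qed.

End Weights.

(** * Restriction of weights to an interval of rows *)

Section Restriction.
Variables (I : finType) (B r : nat).
Implicit Types (a : I -> nat -> nat) (C : {set I}) (s L P Q : nat).

Lemma weight_mulb a i u v N : v <= N ->
  weight a i u v = \sum_(0 <= k < N) (u <= k < v) * a i k.
Proof.
move=> vN; rewrite /weight (big_nat_widen _ _ _ _ _ vN) (big_nat_widenl _ 0) //.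
by rewrite big_mkcond; apply: eq_bigr => k _ /=; case: (u <= k); case: (k < v); rewrite ?mul1n.
Qed.

Definition restr a p q i y := if p <= y < q then a i y else 0.

Definition clamp p q z := maxn p (minn z q).

Lemma weight_restr a p q i x y : p <= q ->
  weight (restr a p q) i x y = weight a i (clamp p q x) (clamp p q y).
Proof.
move=> pq; have h1 : y <= maxn y q by rewrite leq_maxl.
have h2 : clamp p q y <= maxn y q by rewrite /clamp; lia.
rewrite (weight_mulb _ _ _ h1) (weight_mulb _ _ _ h2); apply: eq_bigr => k _.
rewrite /restr /clamp; case: (boolP (p <= k < q)) => pkq; first by congr (nat_of_bool _ * _); lia.
by rewrite muln0; case: (boolP (_ <= k < _)) => // h; lia.
Qed.

Lemma path_restr a p q i y0 ys : p <= q ->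
  path (fun x y => B <= weight (restr a p q) i x y) y0 ys ->
  path (fun x y => B <= weight a i x y) (clamp p q y0) (map (clamp p q) ys).
Proof.
by move=> pq; rewrite path_map; apply: sub_path => x y; rewrite weight_restr.
Qed.

(** The map [h] acts on the list of all [s.+1] ends, so that adding intervals at the sides and
    passing from groups to rows are both instances. *)
Lemma formation_map s s' a a' C C' (h : seq nat -> seq nat) :
  C' \subset C -> (forall l, size l = s.+1 -> size (h l) = s'.+1) ->
  (forall i l, i \in C' -> size l = s.+1 ->
    sorted (fun x y => B <= weight a' i x y) l ->
    sorted (fun x y => B <= weight a i x y) (h l)) ->
  formation B r s a' C' -> formation B r s' a C.
Proof.
move=> sC sh ph [y0 [ys [sys rC]]].
have szl : size (y0 :: ys) = s.+1 by rewrite /= sys.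
have := sh _ szl; case E: (h (y0 :: ys)) => [|z0 zs] //= [szs].
exists z0, zs; split=> //; apply: leq_trans rC _; apply/subset_leq_card/subsetP => i.
rewrite !inE => /andP[iC' /(ph i (y0 :: ys) iC' szl)]; rewrite E /= => ->.
by rewrite (subsetP sC).
Qed.

(** Clamping the ends to the rows from [p] to [q] keeps all weights of [restr]. The last clamped end
    is at most [q], so from there to [M] there is weight at least [B]. The next two lemmas extend on
    the left and on both sides. *)
Lemma formation_restr_r s a p q M C C' : p <= q -> C' \subset C ->
  (forall i, i \in C' -> B <= weight a i q M) ->
  formation B r s (restr a p q) C' -> formation B r s.+1 a C.
Proof.
move=> pq sC wq; apply: (formation_map (h := fun l => rcons (map (clamp p q) l) M)) => //.
  by move=> l sl; rewrite size_rcons size_map sl.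
move=> i [|y0 ys] // iC' _ /= /(path_restr pq) h; rewrite rcons_path h /= last_map.
by apply: leq_trans (wq i iC') _; apply: weight_sub; rewrite // /clamp; lia.
Qed.

Lemma formation_restr_l s a p q C C' : p <= q -> C' \subset C ->
  (forall i, i \in C' -> B <= weight a i 0 p) ->
  formation B r s (restr a p q) C' -> formation B r s.+1 a C.
Proof.
move=> pq sC wq; apply: (formation_map (h := fun l => 0 :: map (clamp p q) l)) => //.
  by move=> l sl; rewrite /= size_map sl.
move=> i [|y0 ys] // iC' _ /= /(path_restr pq) ->; rewrite andbT.
by apply: leq_trans (wq i iC') _; apply: weight_sub; rewrite // /clamp; lia.
Qed.

Lemma formation_restr_lr s a p q M C C' : p <= q -> C' \subset C ->
  (forall i, i \in C' -> B <= weight a i 0 p) ->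
  (forall i, i \in C' -> B <= weight a i q M) ->
  formation B r s (restr a p q) C' -> formation B r s.+2 a C.
Proof.
move=> pq sC wp wq.
apply: (formation_map (h := fun l => 0 :: rcons (map (clamp p q) l) M)) => //.
  by move=> l sl; rewrite /= size_rcons size_map sl.
move=> i [|y0 ys] // iC' _ /= /(path_restr pq) h; rewrite rcons_path h /= last_map.
apply/andP; split.
  by apply: leq_trans (wp i iC') _; apply: weight_sub; rewrite // /clamp; lia.
by apply: leq_trans (wq i iC') _; apply: weight_sub; rewrite // /clamp; lia.
Qed.

Hypothesis B_gt0 : 0 < B.

Lemma weight_bound_restr s m L P Q a C M p q : weight_bound I B r s m L P Q ->
  (forall i y, a i y <= L) -> p <= q -> q <= M -> q - p <= m ->
  ~ formation B r s (restr a p q) C ->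
  \sum_(i in C) weight a i p q <= P * #|C| + r * Q * (q - p).
Proof.
move=> H aL pq qM qpm nF.
have := H (restr a p q) C M p q; set S := \sum_(i in C) _ => h.
rewrite (_ : \sum_(i in C) _ = S); first apply: h => //.
- by move=> i y; rewrite /restr; case: ifP.
- by move=> i y My; rewrite /restr; case: ifP => //; lia.
- by rewrite pq.
- by move=> i _; rewrite weight_restr // weight_nil // /clamp; lia.
- by move=> i _; rewrite weight_restr // weight_nil // /clamp; lia.
by apply: eq_bigr => i _; rewrite weight_restr //; congr weight; rewrite /clamp; lia.
Qed.

End Restriction.

(** * The recursion over groups of rows *)

Section Recursion.
Variables (I : finType) (B r : nat).
Hypothesis B_gt0 : 0 < B.
Implicit Types (a : I -> nat -> nat) (C : {set I}) (s L P Q : nat).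

Lemma weight_sum a i (p : nat -> nat) x y : {homo p : u v / u <= v} -> x <= y ->
  \sum_(x <= g < y) weight a i (p g) (p g.+1) = weight a i (p x) (p y).
Proof.
move=> pm; elim: y => [|y IH]; first by rewrite leqn0 => /eqP ->; rewrite big_geq ?weight_nil.
rewrite leq_eqVlt => /orP[/eqP ->|]; first by rewrite big_geq ?weight_nil.
rewrite ltnS => xy; rewrite big_nat_recr //= IH // -weight_cat //.
by rewrite !pm.
Qed.

Lemma sum_by_group n (A : {set I}) (h : I -> 'I_n) (F : nat -> I -> nat) P Q
    (p : nat -> nat) : {homo p : u v / u <= v} ->
  (forall g : 'I_n, \sum_(i in [set i in A | h i == g]) F g i <=
     P * #|[set i in A | h i == g]| + Q * (p g.+1 - p g)) ->
  \sum_(i in A) F (h i) i <= P * #|A| + Q * (p n - p 0).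
Proof.
move=> pm H; rewrite (partition_big h xpredT) //=.
have -> : #|A| = \sum_(g < n) #|[set i in A | h i == g]|.
  rewrite -sum1_card (partition_big h xpredT) //=.
  by apply: eq_bigr => g _; rewrite -sum1_card; apply: eq_bigl => i; rewrite inE.
have -> : p n - p 0 = \sum_(g < n) (p g.+1 - p g).
  elim: (n) => [|k IH]; first by rewrite big_ord0 subnn.
  by rewrite big_ord_recr /= -IH; have := pm 0 k (leq0n _); have := pm k k.+1 (leqnSn _); lia.
rewrite !big_distrr /= -big_split /=; apply: leq_sum => g _; apply: leq_trans (H g).
apply: eq_leq; apply: eq_big => [i|i /andP[_ /eqP ->] //].
by rewrite inE.
Qed.

(* The rows are cut into at most [b] groups of [q] rows. A column is local if its
   weight is concentrated in one group; otherwise it is split into its first group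
   [gL], its last group [gR] and the groups in between. A formation inside a
   first, last or middle group extends by one interval on one or both sides. The
   middle groups in which a column weighs at most [L'] are treated as single rows. *)
Lemma weight_bound_rec s m L q b P0 Q0 P1 Q1 L' Q2 Pc Qc P Q :
  0 < q -> m <= b * q ->
  weight_bound I B r s.+2 q L P0 Q0 -> weight_bound I B r s.+1 q L P1 Q1 ->
  weight_bound I B r s q L L' Q2 -> weight_bound I B r s.+2 b L' Pc Qc ->
  P0 <= P -> 2 * B + 2 * P1 + Pc <= P -> (Q0 + 2 * Q1 + Q2) * q + 2 * Qc <= Q * q ->
  weight_bound I B r s.+2 m L P Q.
Proof.
move=> q0 mbq H0 H1 H2 Hc P0P PP QQ a C M lo hi aL a0 lhM lenm h1 h2 nF.
have /andP[lh hM] := lhM.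
have B2P : 2 * B <= P by lia.
have [lenq|lenq] := leqP (hi - lo) q.
  apply: leq_trans (H0 a C M lo hi aL a0 lhM lenq h1 h2 nF) _.
  apply: leq_add; rewrite leq_mul ?leq_mul // -(leq_pmul2r q0); lia.
pose n := (hi - lo).-1 %/ q.
have nq : n * q < hi - lo by have := leq_trunc_div (hi - lo).-1 q; rewrite -/n; lia.
have qn : hi - lo <= n.+1 * q.
  by have := ltn_ceil (hi - lo).-1 q0; rewrite -/n; lia.
have nb : n < b by rewrite -(ltn_pmul2r q0); lia.
pose p g := minn (lo + g * q) hi.
have pm : {homo p : u v / u <= v}.
  by move=> u v uv; have : u * q <= v * q; [rewrite leq_mul2r uv orbT | rewrite /p; lia].
have p0 : p 0 = lo by rewrite /p mul0n addn0; lia.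
have pn g : n < g -> p g = hi.
  by move=> ng; have : n.+1 * q <= g * q; [rewrite leq_mul2r ng orbT | rewrite /p; lia].
have pq g : p g.+1 - p g <= q by rewrite /p mulSn; lia.
have lop g : lo <= p g by rewrite -p0 pm.
have phi g : p g <= hi by rewrite /p geq_minr.
have pM g : p g <= M by apply: leq_trans (phi g) hM.
(* [gL i] is the last group before which the column weighs less than [B], and [gR i] the first one
   after which it does. A group strictly between them has weight at least [B] on both sides. *)
pose gL i := [arg max_(g > (ord0 : 'I_n.+1) | weight a i 0 (p g) < B) (g : nat)].
pose gR i := [arg min_(g < (ord_max : 'I_n.+1) | weight a i (p g.+1) M < B) (g : nat)].
have gLP i : i \in C -> weight a i 0 (p (gL i)) < B /\
    forall g, g < n.+1 -> gL i < g -> B <= weight a i 0 (p g).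
  move=> iC; rewrite /gL; case: arg_maxnP; first by rewrite p0 h1.
  move=> g gB gmax; split=> // k kn gk; rewrite leqNgt; apply/negP => kB.
  by have /= := gmax (Ordinal kn) kB; lia.
have gRP i : i \in C -> weight a i (p (gR i).+1) M < B /\
    forall g, g < gR i -> B <= weight a i (p g.+1) M.
  move=> iC; rewrite /gR; case: arg_minnP; first by rewrite pn ?h2 //= ltnS leqnn.
  move=> g gB gmin; split=> // k gk; rewrite leqNgt; apply/negP => kB.
  by have /= := gmin (Ordinal (ltn_trans gk (ltn_ord g))) kB; lia.
pose w g i := weight a i (p g) (p g.+1).
pose loc := [set i in C | gR i <= gL i].
pose glo := [set i in C | gL i < gR i].
have locC : loc \subset C by apply/subsetP => i; rewrite inE => /andP[].
have gloC : glo \subset C by apply/subsetP => i; rewrite inE => /andP[].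
have plen : p n.+1 - p 0 = hi - lo by rewrite p0 pn.
have bloc : \sum_(i in loc) weight a i 0 M <= P0 * #|loc| + r * Q0 * (hi - lo).
  rewrite -plen; apply: (@sum_by_group _ _ gL (fun=> fun i => weight a i 0 M)) => // g.
  have sub : [set i in loc | gL i == g] \subset C.
    by apply: subset_trans locC; apply/subsetP => i; rewrite inE => /andP[].
  apply: H0 => //; first by rewrite pm ?pM.
  - by move=> i; rewrite !inE => /andP[/andP[iC _] /eqP <-]; have [] := gLP i iC.
  - move=> i; rewrite !inE => /andP[/andP[iC le] /eqP <-]; have [lt _] := gRP i iC.
    by apply: leq_ltn_trans lt; apply: weight_sub => //; apply: pm.
  - by apply: contra_not nF; apply: (formation_map (h := id)).
have bL : \sum_(i in glo) w (gL i) i <= P1 * #|glo| + r * Q1 * (hi - lo).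
  rewrite -plen; apply: (@sum_by_group _ _ gL w) => // g.
  apply: (weight_bound_restr B_gt0 H1 aL _ (pM _) (pq g)); first exact: pm.
  apply: contra_not nF; apply: formation_restr_r; first exact: pm.
    by apply: subset_trans gloC; apply/subsetP => i; rewrite inE => /andP[].
  move=> i; rewrite !inE => /andP[/andP[iC lt] /eqP eg]; have [_] := gRP i iC.
  by apply; rewrite -eg.
have bR : \sum_(i in glo) w (gR i) i <= P1 * #|glo| + r * Q1 * (hi - lo).
  rewrite -plen; apply: (@sum_by_group _ _ gR w) => // g.
  apply: (weight_bound_restr B_gt0 H1 aL _ (pM _) (pq g)); first exact: pm.
  apply: contra_not nF; apply: formation_restr_l; first exact: pm.
    by apply: subset_trans gloC; apply/subsetP => i; rewrite inE => /andP[].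
  move=> i; rewrite !inE => /andP[/andP[iC lt] /eqP eg]; have [_] := gLP i iC.
  by apply; rewrite // -eg.
pose E (g : nat) := [set i in glo | (gL i < g < gR i) && (L' < w g i)].
(* Each column in [E g] weighs more than [L'] in the group [g], and [L'] is the column coefficient
   for [s] intervals. Subtracting [L'] from each of them leaves only the row term. *)
have bE : \sum_(i in glo) \sum_(g < n.+1 | gL i < g < gR i) (w g i - L') <= r * Q2 * (hi - lo).
  rewrite (exchange_big_dep xpredT) //=.
  have -> : hi - lo = \sum_(g < n.+1) (p g.+1 - p g).
    rewrite -plen; elim: (n.+1) => [|k IH]; first by rewrite big_ord0 subnn.
    by rewrite big_ord_recr /= -IH; have := pm 0 k (leq0n _); have := pm k k.+1 (leqnSn _); lia.
  rewrite big_distrr /=; apply: leq_sum => g _.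
  have -> : \sum_(i in glo | gL i < g < gR i) (w g i - L') = \sum_(i in E g) (w g i - L').
    rewrite big_mkcond [RHS]big_mkcond /=; apply: eq_bigr => i _; rewrite [i \in E g]inE.
    case: (i \in glo) => //=; case: (gL i < g < gR i) => //=.
    by have [//|le] := ltnP L' (w g i); apply/eqP; rewrite subn_eq0.
  have : \sum_(i in E g) w g i <= L' * #|E g| + r * Q2 * (p g.+1 - p g).
    apply: (weight_bound_restr B_gt0 H2 aL _ (pM _) (pq g)); first exact: pm.
    apply: contra_not nF; apply: formation_restr_lr; first exact: pm.
    - by apply: subset_trans gloC; apply/subsetP => i; rewrite inE => /andP[].
    - move=> i; rewrite !inE => /and3P[/andP[iC _] /andP[lt _] _]; have [_] := gLP i iC.
      by apply.
    - move=> i; rewrite !inE => /and3P[/andP[iC _] /andP[_ lt] _]; have [_] := gRP i iC.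
      by apply.
  have -> : \sum_(i in E g) w g i = \sum_(i in E g) (w g i - L') + L' * #|E g|.
    rewrite mulnC -sum_nat_const -big_split /=; apply: eq_bigr => i.
    by rewrite inE => /and3P[_ _ lt]; rewrite subnK // ltnW.
  by lia.
(* The contracted weights, with groups as rows, are capped at [L'] to suit [Hc]; the excess is
   already bounded by [bE]. *)
pose a' i g := minn (w g i) L'.
have bc : \sum_(i in glo) weight a' i 0 n.+1 <= Pc * #|glo| + r * Qc * n.+1.
  have := Hc a' glo n.+1 0 n.+1; rewrite subn0; apply; rewrite ?leqnn //.
  - by move=> i y; rewrite geq_minr.
  - by move=> i y ny; rewrite /a' /w !pn ?weight_nil ?min0n // ltnW.
  - by move=> i _; rewrite weight_nil.
  - by move=> i _; rewrite weight_nil.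
  apply: contra_not nF; apply: (formation_map (h := map p)) => //.
    by move=> l; rewrite size_map.
  move=> i l _ _; rewrite sorted_map; apply: sub_sorted => x y le.
  have xy : x < y by apply: (@weight_ltn _ a' i); apply: leq_trans B_gt0 le.
  apply: leq_trans le _; rewrite -weight_sum //; last exact: ltnW.
  by apply: leq_sum => g _; rewrite geq_minl.
have one i : i \in glo -> weight a i 0 M <= 2 * B + w (gL i) i + w (gR i) i +
    weight a' i 0 n.+1 + \sum_(g < n.+1 | gL i < g < gR i) (w g i - L').
  rewrite inE => /andP[iC lt]; have [l1 _] := gLP i iC; have [r1 _] := gRP i iC.
  have e1 : weight a i 0 M = weight a i 0 (p (gL i)) + w (gL i) i +
      weight a i (p (gL i).+1) (p (gR i)) + w (gR i) i + weight a i (p (gR i).+1) M.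
    rewrite (@weight_cat _ a i 0 (p (gL i))) ?pM // -!addnA; congr (_ + _).
    rewrite (@weight_cat _ a i _ (p (gL i).+1)) ?pm ?pM //; congr (_ + _).
    rewrite (@weight_cat _ a i _ (p (gR i))) ?pm ?pM //; congr (_ + _).
    by rewrite (@weight_cat _ a i _ (p (gR i).+1)) ?pm ?pM.
  have e2 : weight a i (p (gL i).+1) (p (gR i)) <= weight a' i 0 n.+1 +
      \sum_(g < n.+1 | gL i < g < gR i) (w g i - L').
    rewrite -weight_sum // /weight.
    rewrite (big_nat_widen _ _ n.+1) ?(ltnW (ltn_ord _)) // (big_nat_widenl _ 0) //.
    rewrite big_mkord [\sum_(0 <= y < n.+1) _]big_mkord.
    apply: leq_trans (_ : \sum_(g < n.+1 | gL i < g < gR i) (a' i g + (w g i - L')) <= _).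
      apply: eq_leq; rewrite big_mkcond [RHS]big_mkcond; apply: eq_bigr => g _.
      rewrite /= andbC; case: (gL i < g < gR i) => //; rewrite /a' /w -/(weight a i _ _); lia.
    rewrite big_split /= leq_add2r big_mkcond; apply: leq_sum => g _; by case: ifP.
  by lia.
have bglo : \sum_(i in glo) weight a i 0 M <= (2 * B + 2 * P1 + Pc) * #|glo| +
    r * (2 * Q1 + Q2) * (hi - lo) + r * Qc * n.+1.
  apply: leq_trans (leq_sum _ one) _; rewrite !big_split /= sum_nat_const big1_eq.
  move: bL bR bE bc; move: (hi - lo) #|glo| => d k.
  do 4![move: (\sum_(i in glo) _) => ?]; clear; nia.
have -> : \sum_(i in C) weight a i 0 M =
    \sum_(i in loc) weight a i 0 M + \sum_(i in glo) weight a i 0 M.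
  rewrite (bigID (fun i => gR i <= gL i)) /=; congr (_ + _); apply: eq_bigl => i.
    by rewrite inE.
  by rewrite inE -ltnNge.
have cC : #|C| = #|loc| + #|glo|.
  rewrite -(cardsID loc C) (setIidPr locC); congr (_ + _); apply: eq_card => i.
  by rewrite !inE ltnNge; case: (i \in C); rewrite //= andbT.
apply: leq_trans (leq_add bloc bglo) _; rewrite cC mulnDr.
have t1 : P0 * #|loc| <= P * #|loc| by rewrite leq_mul2r P0P orbT.
have t2 : (2 * B + 2 * P1 + Pc) * #|glo| <= P * #|glo| by rewrite leq_mul2r PP orbT.
have t3 : (Q0 + 2 * Q1 + Q2) * (hi - lo) + Qc * n.+1 <= Q * (hi - lo).
  rewrite -(leq_pmul2r q0) mulnDl -mulnA [(hi - lo) * q]mulnC mulnA.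
  (* There are more than [q] rows, so rounding up the number of groups costs at most a factor 2;
     hence [2 * Qc] in the hypothesis. *)
  have nq2 : n.+1 * q <= 2 * (hi - lo) by rewrite mulSn; lia.
  have : Qc * n.+1 * q <= 2 * Qc * (hi - lo) by nia.
  have := leq_mul QQ (leqnn (hi - lo)); nia.
have := leq_mul (leqnn r) t3; move: t1 t2; move: (hi - lo) #|loc| #|glo| => d k l.
by clear; nia.
Qed.

End Recursion.

(** * The inverse Ackermann hierarchy and the coefficients of the bounds *)

(* [ack k] is inverse to [alphad k.+1]. *)
Fixpoint ack (k j : nat) : nat := if k is k'.+1 then iter j (ack k') 1 else 2 * j.

Lemma ackS k j : ack k.+1 j.+1 = ack k (ack k.+1 j).
Proof. by []. Qed.

Lemma ack_at1 k : ack k 1 = 2.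
Proof. by elim: k. Qed.

Lemma ack_gt k j : 0 < j -> j < ack k j.
Proof.
elim: k j => [|k IH] j j0; first by rewrite /=; lia.
elim: j j0 => // -[_ _|j /(_ isT) IHj _]; first by rewrite ack_at1.
by rewrite ackS; apply: (leq_ltn_trans IHj (IH _ _)); apply: leq_ltn_trans IHj.
Qed.

Lemma ackS_gt0 k j : 0 < ack k.+1 j.
Proof. by case: j => // j; apply: leq_ltn_trans (ack_gt k.+1 (ltn0Sn j)). Qed.

(** The recursion [alphad_rec] unwinds in step with [ackS]. *)
Lemma alphad_leP k m j : alphad k.+1 m <= j -> m <= ack k j.
Proof.
elim: k m j => [|k IH] m j; first by rewrite alphad_1m /=; lia.
elim/ltn_ind: m j => m IHm j.
have [m1 _|m1] := leqP m 1; first by apply: leq_trans m1 (ackS_gt0 _ _).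
rewrite alphad_rec // -pred_Sn; case: j => // j; rewrite ltnS => lej.
apply: IH; apply: IHm lej.
by have := alphad_le k m; lia.
Qed.

(* For [ack k.+1 j ^ e] rows, each column contributes [cx k * L + cy k * B] and
   each row [r * (cu k * L + cv k * B)], up to a power of [j]. *)
Record coefs := Coefs { cx : nat -> nat; cy : nat -> nat; cu : nat -> nat; cv : nat -> nat }.

Section Coefficients.
Variable e : nat.

(** With [f0] and [f1] for [s] and [s.+1] intervals, the four recurrences for [s.+2] are read off
    [weight_bound_rec], where [L'] is the column term of [f0]. The contracted rows are bounded by
    the level [k'], and trivially at level 0, which has only [2 ^ e] groups. The halving in [next_u]
    and [next_v] reflects the size of the groups. *)
Fixpoint next_x (f0 f1 : coefs) k := if k is k'.+1
  then maxn (next_x f0 f1 k') (2 * cx f1 k + next_x f0 f1 k' * cx f0 k)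
  else maxn 1 (2 * cx f1 0 + 2 ^ e * cx f0 0).

Fixpoint next_y (f0 f1 : coefs) k := if k is k'.+1
  then 2 + 2 * cy f1 k + next_x f0 f1 k' * cy f0 k + next_y f0 f1 k'
  else 4 + 2 * cy f1 0 + 2 ^ e * cy f0 0.

Fixpoint next_u (f0 f1 : coefs) k := if k is k'.+1
  then maxn (next_u f0 f1 k') (2 * cu f1 k + cu f0 k + uphalf (next_u f0 f1 k' * cx f0 k))
  else 2 * cu f1 0 + cu f0 0.

Fixpoint next_v (f0 f1 : coefs) k := if k is k'.+1
  then maxn (next_v f0 f1 k')
    (2 * cv f1 k + cv f0 k + uphalf (next_u f0 f1 k' * cy f0 k + next_v f0 f1 k'))
  else 2 * cv f1 0 + cv f0 0.

Definition next_coefs f0 f1 :=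
  Coefs (next_x f0 f1) (next_y f0 f1) (next_u f0 f1) (next_v f0 f1).

Definition coefs1 := Coefs (fun=> 0) (fun=> 2) (fun=> 1) (fun=> 0).
Definition coefs2 := Coefs (fun=> 1) (fun=> 2) (fun=> 1) (fun=> 0).

(** The components belong to [s.+1] and [s.+2] intervals; keeping both makes the two-step recursion
    structural. *)
Fixpoint coefs_pair s : coefs * coefs := if s is s'.+1
  then let f := coefs_pair s' in (f.2, next_coefs f.1 f.2) else (coefs1, coefs2).

Definition coefs_of s := (coefs_pair s.-1).1.

Lemma coefs_ofS s : coefs_of s.+3 = next_coefs (coefs_of s.+1) (coefs_of s.+2).
Proof. by []. Qed.

Definition bounds s f := forall (I : finType) B r k j L, 0 < B ->
  weight_bound I B r s (ack k.+1 j ^ e) L (cx f k * L + cy f k * B)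
    ((cu f k * L + cv f k * B) * j.+1 ^ s).

Lemma bounds1 : bounds 1 coefs1.
Proof.
move=> I B r k j L B0; apply: weight_boundW (@weight_bound1 I B r (ack k.+1 j ^ e) L) => //=.
by rewrite mul1n mul0n addn0 leq_pmulr // expn_gt0.
Qed.

Lemma bounds2 : bounds 2 coefs2.
Proof.
move=> I B r k j L B0; apply: weight_boundW (@weight_bound2 I B r (ack k.+1 j ^ e) L) => //=.
  by lia.
by rewrite mul1n mul0n addn0 leq_pmulr // expn_gt0.
Qed.

Lemma expnS_ge t s : t ^ s.+1 + t ^ s <= t.+1 ^ s.+1.
Proof.
by rewrite addnC (expnS t) (expnS t.+1) -mulSn leq_mul2l; case: s => // s;
  rewrite leq_exp2r ?leqnSn.
Qed.

Lemma next_x_gt0 f0 f1 k : 0 < next_x f0 f1 k.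
Proof. by elim: k => [|k IH] /=; lia. Qed.

Lemma next_y_ge2 f0 f1 k : 2 <= next_y f0 f1 k.
Proof. by elim: k => [|k IH] /=; lia. Qed.

(** Induction on [k], then on [j], where the groups have the size of the bound for [j]. The column
    coefficients do not depend on [j]; the step from [j] to [j.+1] adds row terms of order
    [j.+1 ^ s.+1], which [expnS_ge] absorbs into [j.+2 ^ s.+2]. *)
Lemma bounds_next s f0 f1 : 2 * s.+2 + 2 <= e ->
  bounds s f0 -> bounds s.+1 f1 -> bounds s.+2 (next_coefs f0 f1).
Proof.
move=> se b0 b1 I B r k j L B0; move: L.
have atj0 h L : weight_bound I B r s.+2 (ack h.+1 0 ^ e) L
    (next_x f0 f1 h * L + next_y f0 f1 h * B)
    ((next_u f0 f1 h * L + next_v f0 f1 h * B) * 1 ^ s.+2).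
  apply: weight_boundW (@weight_bound_trivial I B r s.+2 1 L) => //; first by rewrite /= exp1n.
  rewrite muln1 addnC leq_add ?leq_mul ?next_y_ge2 //.
  by rewrite leq_pmull // next_x_gt0.
elim: k j => [|k IHk] j L.
  elim: j => [|j IHj]; first exact: (atj0 0).
  set t := j.+1.
  have q0 : 0 < ack 1 j ^ e by rewrite expn_gt0 ackS_gt0.
  apply: (weight_bound_rec (b := 2 ^ e) B0 q0 _ IHj (b1 I B r 0 j L B0) (b0 I B r 0 j L B0)
            (@weight_bound_trivial _ _ _ _ _ _)).
  - by rewrite ackS /= expnMn.
  - by [].
  - rewrite /=; move: (2 ^ e) => X.
    have := leq_mul (leq_maxr 1 (2 * cx f1 0 + X * cx f0 0)) (leqnn L).
    by move: (maxn _ _ * L) => Y; nia.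
  rewrite muln0 addn0 leq_mul2r; apply/orP; right; rewrite -/t.
  have := expnS_ge t s.+1; rewrite /= (expnS t s).
  have t0 : 0 < t by []; have : 0 < t ^ s by rewrite expn_gt0.
  move: (t ^ s) (t.+1 ^ s.+2) (t ^ s.+2) => T T2 T3 _ hT.
  set X1 := cu f1 0 * L + cv f1 0 * B; set X2 := cu f0 0 * L + cv f0 0 * B.
  set X := (2 * _ + _) * L + _; have -> : X = 2 * X1 + X2 by rewrite /X /X1 /X2; lia.
  apply: leq_trans (leq_mul (leqnn _) hT).
  have : X2 * T <= X2 * (t * T) by rewrite leq_mul2l leq_pmull ?orbT.
  by rewrite mulnDr; lia.
case: j => [|j]; first exact: (atj0 k.+1).
elim: j => [|j IHj].
  (* At index 1 every level has [2 ^ e] rows, so the bound of the previous level applies. *)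
  apply: weight_boundW (IHk 1 L); rewrite ?ack_at1 ?leqnn //=.
    by rewrite leq_add // leq_mul //; lia.
  by rewrite leq_mul // leq_add // leq_mul //; lia.
set t := j.+2; set J := ack k.+2 j.+1 in IHj *.
have J1 : 1 < J by apply: leq_ltn_trans (ack_gt _ _).
(* This is the purpose of the exponent [e]: the group size outweighs the factor [J.+1 ^ s.+2] of the
   contracted bound four times, which halves that contribution. It needs [1 < J], so index 1 is
   treated separately. *)
have hq : 4 * J.+1 ^ s.+2 <= J ^ e.
  apply: leq_trans (_ : 4 * (2 * J) ^ s.+2 <= _).
    by rewrite leq_mul2l leq_exp2r //; lia.
  rewrite expnMn mulnA -[4]/(2 ^ 2) -expnD.
  apply: leq_trans (_ : J ^ (2 + s.+2) * J ^ s.+2 <= _);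
    first by rewrite leq_mul2r leq_exp2r // J1 orbT.
  by rewrite -expnD leq_pexp2l //; lia.
have q0 : 0 < J ^ e by rewrite expn_gt0 ltnW.
apply: (weight_bound_rec (b := ack k.+2 j.+2 ^ e) B0 q0 _ IHj (b1 I B r k.+1 j.+1 L B0)
    (b0 I B r k.+1 j.+1 L B0) (IHk J _)).
- by rewrite leq_pmulr.
- by [].
- by rewrite /=; nia.
rewrite -/t /=.
set u' := maxn _ _; set v' := maxn _ _.
have hu : 4 * cu f1 k.+1 + 2 * cu f0 k.+1 + next_u f0 f1 k * cx f0 k.+1 <= 2 * u'.
  by rewrite /u'; move: (_ * cx f0 _) => X; lia.
have hv : 4 * cv f1 k.+1 + 2 * cv f0 k.+1 + (next_u f0 f1 k * cy f0 k.+1 + next_v f0 f1 k) <=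
  2 * v'.
  by rewrite /v'; move: (_ * cy f0 _) => X; lia.
have := expnS_ge t s.+1; rewrite (expnS t s).
have t0 : 0 < t by []; have : 0 < t ^ s by rewrite expn_gt0.
have hX : 4 * (cu f1 k.+1 * L + cv f1 k.+1 * B) + 2 * (cu f0 k.+1 * L + cv f0 k.+1 * B) +
   (next_u f0 f1 k * (cx f0 k.+1 * L + cy f0 k.+1 * B) + next_v f0 f1 k * B) <=
   2 * (u' * L + v' * B).
  have := leq_mul hu (leqnn L); have := leq_mul hv (leqnn B); clear; nia.
move: hX hq; move: (_ * L + _ * B) => X1; move: (_ * L + _ * B) => X2.
move: (next_u _ _ _ * _ + _) => Xc; move: (u' * L + v' * B) => X.
move: (t ^ s) (t.+1 ^ s.+2) (t ^ s.+2) (J ^ e) (J.+1 ^ s.+2) => T T2 T3 q K hX hq T0 hT.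
have TtT : T <= t * T by rewrite leq_pmull.
move: (t * T) TtT hT => Z TZ hT.
apply: leq_trans (leq_mul (leq_mul (leqnn X) hT) (leqnn q)).
have h1 := leq_mul hX (leqnn (Z * q)).
have h2 : X2 * T * q <= X2 * Z * q by rewrite leq_mul2r leq_mul2l TZ !orbT.
have h3 : Xc * (4 * K) <= Xc * (Z * q).
  by rewrite leq_mul2l (leq_trans hq) ?orbT // leq_pmull // (leq_trans T0).
clear -h1 h2 h3; nia.
Qed.

Lemma bounds_coefs s : 0 < s -> 2 * s + 2 <= e -> bounds s (coefs_of s).
Proof.
case: s => // s _; elim/ltn_ind: s => -[|[|s]] IH se; first exact: bounds1.
  exact: bounds2.
by rewrite coefs_ofS; apply: bounds_next => //; apply: IH; lia.
Qed.

End Coefficients.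

(** * Growth of the coefficients *)

Lemma ltn_pow2 n : n < 2 ^ n. Proof. exact: ltn_expl. Qed.

Lemma bin_gt_sub n t : 0 < t -> t <= n -> n - t < 'C(n, t).
Proof.
case: t => // t _; elim: n => // n IH; rewrite ltnS leq_eqVlt => /orP[/eqP ->|tn].
  by rewrite subnn binn.
by rewrite binS; have := IH tn; have : 0 < 'C(n, t) by [rewrite bin_gt0 ltnW]; lia.
Qed.

Lemma bin_add2 n t : t <= n -> 'C(n, t.+1) + 2 <= 'C(n.+2, t.+1).
Proof.
move=> tn; rewrite !binS; have : 0 < 'C(n, t) by rewrite bin_gt0.
have : 'C(n, t) <= 'C(n.+1, t) by apply: leq_bin2l.
by lia.
Qed.

Lemma linear_up_log T : exists c, forall n, T * up_log 2 n <= n + c.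
Proof.
exists (T * T + T) => n; have [n1|n1] := leqP n 1.
  by have /eqP -> : up_log 2 n == 0; rewrite ?up_log_eq0 ?n1 // muln0.
have := up_log_gtn (isT : 1 < 2) n1.
have : 0 < up_log 2 n by rewrite up_log_gt0.
case: (up_log 2 n) => // l _; rewrite -pred_Sn => ln.
suff : T * l <= 2 ^ l + T * T by rewrite mulnS; lia.
elim: l {ln} => [|l IH]; first by rewrite muln0.
have [lT|Tl] := ltnP l T; first by apply: leq_trans (leq_addl _ _); rewrite leq_mul2l lT orbT.
by rewrite mulnS expnS; have := ltn_pow2 l; lia.
Qed.

Section Growth.
Variable e : nat.
Local Notation f s := (coefs_of e s).

Lemma cx0 s : cx (f s.+3) 0 = maxn 1 (2 * cx (f s.+2) 0 + 2 ^ e * cx (f s.+1) 0).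
Proof. by []. Qed.

Lemma cy0 s : cy (f s.+3) 0 = 4 + 2 * cy (f s.+2) 0 + 2 ^ e * cy (f s.+1) 0.
Proof. by []. Qed.

Lemma cu0 s : cu (f s.+3) 0 = 2 * cu (f s.+2) 0 + cu (f s.+1) 0.
Proof. by []. Qed.

Lemma cv0 s : cv (f s.+3) 0 = 2 * cv (f s.+2) 0 + cv (f s.+1) 0.
Proof. by []. Qed.

Lemma cxS s k : cx (f s.+3) k.+1 = maxn (cx (f s.+3) k)
  (2 * cx (f s.+2) k.+1 + cx (f s.+3) k * cx (f s.+1) k.+1).
Proof. by []. Qed.

Lemma cyS s k : cy (f s.+3) k.+1 =
  2 + 2 * cy (f s.+2) k.+1 + cx (f s.+3) k * cy (f s.+1) k.+1 + cy (f s.+3) k.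
Proof. by []. Qed.

Lemma cuS s k : cu (f s.+3) k.+1 = maxn (cu (f s.+3) k)
  (2 * cu (f s.+2) k.+1 + cu (f s.+1) k.+1 + uphalf (cu (f s.+3) k * cx (f s.+1) k.+1)).
Proof. by []. Qed.

Lemma cvS s k : cv (f s.+3) k.+1 = maxn (cv (f s.+3) k)
  (2 * cv (f s.+2) k.+1 + cv (f s.+1) k.+1 +
   uphalf (cu (f s.+3) k * cy (f s.+1) k.+1 + cv (f s.+3) k)).
Proof. by []. Qed.

Lemma coefs1_val k : (cx (f 1) k = 0) * (cy (f 1) k = 2) * (cu (f 1) k = 1) * (cv (f 1) k = 0).
Proof. by []. Qed.

Lemma coefs2_val k : (cx (f 2) k = 1) * (cy (f 2) k = 2) * (cu (f 2) k = 1) * (cv (f 2) k = 0).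
Proof. by []. Qed.

Lemma coefs3_growth : exists c, forall k, [/\ cx (f 3) k = 2, cy (f 3) k <= c * k.+1,
  cu (f 3) k = 3 & cv (f 3) k <= 6].
Proof.
exists (18 + 2 * 2 ^ e) => k; have x3 j : cx (f 3) j = 2.
  by elim: j => [|j IH]; rewrite ?cx0 ?cxS ?IH !coefs1_val ?coefs2_val ?muln0.
have u3 j : cu (f 3) j = 3.
  by elim: j => [|j IH]; rewrite ?cu0 ?cuS ?IH !coefs1_val ?coefs2_val.
split=> //; last first.
  by elim: k => [|k IH] //; rewrite cvS u3 !coefs1_val ?coefs2_val; lia.
elim: k => [|k IH]; first by rewrite cy0 coefs1_val ?coefs2_val; lia.
by rewrite cyS x3 coefs1_val ?coefs2_val; lia.
Qed.

(** Since [cx (f 2) = 1], [cx] grows by 4 per level, and the halving keeps the row coefficients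
    bounded: [14 = 2 * 3 + 1 + 14 / 2] and [52 = 2 * 6 + (14 * 2 + 52) / 2] are fixed points. *)
Lemma coefs4_growth : exists c, forall k, [/\ cx (f 4) k <= c * k.+1,
  cy (f 4) k <= c * k.+1 ^ 2, cu (f 4) k <= 14 & cv (f 4) k <= 52].
Proof.
have [c3 h3] := coefs3_growth.
pose c := 4 + 2 ^ e.
have x4 k : cx (f 4) k <= c * k.+1.
  elim: k => [|k IH]; first by rewrite cx0 coefs2_val; have [-> _ _ _] := h3 0; rewrite /c; lia.
  by rewrite cxS coefs2_val; have [-> _ _ _] := h3 k.+1; lia.
have u4 k : cu (f 4) k <= 14.
  elim: k => [|k IH]; first by rewrite cu0 coefs2_val; have [_ _ -> _] := h3 0.
  by rewrite cuS !coefs2_val; have [_ _ -> _] := h3 k.+1; lia.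
exists (2 * c3 + 2 * c + 10 + 2 * 2 ^ e) => k; split=> //.
- by apply: leq_trans (x4 k) _; rewrite leq_mul2r; apply/orP; right; lia.
- elim: k => [|k IH]; first by rewrite cy0 coefs2_val; have [_ y3 _ _] := h3 0; lia.
  rewrite cyS coefs2_val; have [_ y3 _ _] := h3 k.+1.
  move: (cy (f 3) _) y3 (cx (f 4) k) (x4 k) (cy (f 4) k) IH.
  by rewrite -!mulnn => y3 ? x x4k z; nia.
elim: k => [|k IH]; first by rewrite cv0 coefs2_val; have [_ _ _ v3] := h3 0; lia.
by rewrite cvS !coefs2_val; have [_ _ _ v3] := h3 k.+1; have := u4 k; lia.
Qed.

(** Since [cx (f 3) = 2], the product term of [cx] doubles at each level; for [cu] the halving
    cancels this doubling and leaves linear growth. *)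
Lemma coefs5_growth : exists c, forall k, [/\ cx (f 5) k <= c * 2 ^ k,
  cy (f 5) k <= c * k.+1 * 2 ^ k, cu (f 5) k <= c * k.+1 & cv (f 5) k <= c * k.+1 ^ 2].
Proof.
have [c3 h3] := coefs3_growth; have [c4 h4] := coefs4_growth.
pose A := 1 + 10 * c4 + 2 * 2 ^ e.
have x5 k : cx (f 5) k <= A * 2 ^ k.
  suff : cx (f 5) k + 2 * c4 * (k + 4) <= A * 2 ^ k by lia.
  elim: k => [|k IH].
    by rewrite cx0; have [-> _ _ _] := h3 0; have [x4 _ _ _] := h4 0; rewrite /A; lia.
  rewrite cxS; have [-> _ _ _] := h3 k.+1; have [x4 _ _ _] := h4 k.+1; rewrite expnS.
  by move: (cx _ _) (cx _ _) IH x4 => x y; nia.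
have u5 k : cu (f 5) k <= 31 * k.+1.
  elim: k => [|k IH].
    by rewrite cu0; have [_ _ -> _] := h3 0; have [_ _ u4 _] := h4 0; lia.
  rewrite cuS; have [-> _ -> _] := h3 k.+1; have [_ _ u4 _] := h4 k.+1.
  by move: (cu _ _) (cu _ _) IH u4 => x y; lia.
pose D := A * c3 + 4 * c4 + 2 * 2 ^ e * c3 + 8.
pose V := 31 * c3 + 226.
exists (A + D + V + 31) => k; split.
- by apply: leq_trans (x5 k) _; rewrite leq_mul2r; apply/orP; right; lia.
- apply: (@leq_trans (D * k.+1 * 2 ^ k)); last
    by rewrite !leq_mul2r; apply/orP; right; apply/orP; right; lia.
  elim: k => [|k IH].
    rewrite cy0; have [_ y3 _ _] := h3 0; have [_ y4 _ _] := h4 0.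
    by rewrite /D; move: (cy _ _) (cy _ _) y4 y3 => y y'; nia.
  have [_ y3 _ _] := h3 k.+1; have [_ y4 _ _] := h4 k.+1; rewrite cyS expnS.
  move: (cx (f 5) k) (cy (f 4) k.+1) (cy (f 3) k.+1) (cy (f 5) k) (2 ^ k) (x5 k) y4 y3 IH
    (ltn_pow2 k).
  move=> x y4 y3 y T h1 h2 h3' h5 kT.
  have xy : x * y3 <= A * c3 * (k.+2 * T).
    by apply: leq_trans (leq_mul h1 h3') _; rewrite [k.+2 * T]mulnC -!mulnA [T * _]mulnCA.
  have yy : y <= D * (k.+2 * T).
    by apply: leq_trans h5 _; rewrite -mulnA leq_mul2l leq_mul2r leqnSn !orbT.
  have y4' : y4 <= 2 * c4 * (k.+2 * T).
    have kk : k.+2 * k.+2 <= k.+2 * (2 * T) by rewrite leq_mul2l; lia.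
    apply: leq_trans h2 _; rewrite -mulnn; apply: leq_trans (leq_mul (leqnn c4) kk) _.
    by rewrite [k.+2 * (2 * T)]mulnCA mulnA [c4 * 2]mulnC.
  have Z0 : 0 < k.+2 * T by rewrite muln_gt0; lia.
  have : (2 + 4 * c4 + A * c3) * (k.+2 * T) <= D * (k.+2 * T).
    by rewrite leq_mul2r; apply/orP; right; rewrite /D; lia.
  have -> : D * k.+2 * (2 * T) = 2 * (D * (k.+2 * T)) by rewrite mulnCA !mulnA.
  move: xy yy y4' Z0; move: (k.+2 * T) => Z; move: (D * Z) => DZ; nia.
- by apply: leq_trans (u5 k) _; rewrite leq_mul2r; apply/orP; right; lia.
apply: (@leq_trans (V * k.+1 ^ 2)); last by rewrite leq_mul2r; apply/orP; right; lia.
elim: k => [|k IH].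
  by rewrite cv0 /V; have [_ _ _ v3] := h3 0; have [_ _ _ v4] := h4 0; lia.
have [_ y3 _ v3] := h3 k.+1; have [_ _ _ v4] := h4 k.+1; rewrite cvS.
have : cu (f 5) k * cy (f 3) k.+1 <= 31 * k.+1 * (c3 * k.+2) by apply: leq_mul.
move: (_ * cy _ _) (cv _ _) (cv _ _) (cv _ _) v4 v3 IH => uy v4 v3 v h1 h2.
by rewrite /V -!mulnn; nia.
Qed.

Definition pow2_bounds s k a b := [/\ cx (f s) k <= 2 ^ a, cu (f s) k <= 2 ^ a,
  cy (f s) k <= 2 ^ b & cv (f s) k <= 2 ^ b].

Lemma pow2_boundsW s k a b a' b' : a <= a' -> b <= b' ->
  pow2_bounds s k a b -> pow2_bounds s k a' b'.
Proof.
move=> aa bb [h1 h2 h3 h4]; split.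
- by apply: leq_trans h1 _; rewrite leq_exp2l.
- by apply: leq_trans h2 _; rewrite leq_exp2l.
- by apply: leq_trans h3 _; rewrite leq_exp2l.
by apply: leq_trans h4 _; rewrite leq_exp2l.
Qed.

(** The recurrences on exponents: products add exponents, and sums of a few terms cost an additive
    constant. *)
Lemma pow2_bounds_next s K (a b a0 b0 d : nat -> nat) :
  (forall k, k <= K -> pow2_bounds s.+1 k (a0 k) (b0 k)) ->
  (forall k, k <= K -> pow2_bounds s.+2 k (d k) (d k)) ->
  pow2_bounds s.+3 0 (a 0) (b 0) ->
  (forall k, k < K -> [/\ a k + a0 k.+1 + 2 <= a k.+1, d k.+1 + 3 <= a k.+1,
     a k + b0 k.+1 + 2 <= b k.+1, d k.+1 + 3 <= b k.+1 & b k + 2 <= b k.+1]) ->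
  forall k, k <= K -> pow2_bounds s.+3 k (a k) (b k).
Proof.
move=> h0 h1 base step; elim=> [|k IH] // kK.
have [x u y v] := IH (ltnW kK); have [x0 u0 y0 v0] := h0 _ kK.
have [x1 u1 y1 v1] := h1 _ kK; have [s1 s2 s3 s4 s5] := step _ kK.
have quarter m n g : m + n + 2 <= g -> 4 * (2 ^ m * 2 ^ n) <= 2 ^ g.
  by move=> le; rewrite -expnD -[4]/(2 ^ 2) -expnD leq_exp2l // addnC.
have q1 := quarter _ _ _ s1; have q3 := quarter _ _ _ s3.
have q2 : 8 * 2 ^ d k.+1 <= 2 ^ a k.+1 by rewrite -[8]/(2 ^ 3) -expnD leq_exp2l // addnC.
have q4 : 8 * 2 ^ d k.+1 <= 2 ^ b k.+1 by rewrite -[8]/(2 ^ 3) -expnD leq_exp2l // addnC.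
have q5 : 4 * 2 ^ b k <= 2 ^ b k.+1 by rewrite -[4]/(2 ^ 2) -expnD leq_exp2l // addnC.
have a0pos := expn_gt0 2 (a k); have a1pos := expn_gt0 2 (a0 k.+1);
  have dpos := expn_gt0 2 (d k.+1).
have b1pos := expn_gt0 2 (b0 k.+1).
have xx := leq_mul x x0; have xy := leq_mul x y0; have ux := leq_mul u x0; have uy := leq_mul u y0.
rewrite /pow2_bounds cxS cuS cyS cvS.
move: (2 ^ a k) (2 ^ a0 k.+1) (2 ^ d k.+1) (2 ^ b k) (2 ^ b0 k.+1) (2 ^ a k.+1) (2 ^ b k.+1)
  a0pos a1pos dpos b1pos x u y v x0 u0 y0 v0 x1 u1 y1 v1 q1 q2 q3 q4 q5 xx xy ux uy.
move=> A A0 D Bk B0 A' B' a0pos a1pos dpos b1pos x u y v x0 u0 y0 v0 x1 u1 y1 v1 q1 q2 q3 q4 q5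
  xx xy ux uy.
have AA : A <= A * A0 by rewrite leq_pmulr.
have AA' : A0 <= A * A0 by rewrite leq_pmull.
have BB' : B0 <= A * B0 by rewrite leq_pmull.
move: xx xy ux uy q1 q3 AA AA' BB'.
move: (cx _ k * cx _ _) (cx _ k * cy _ _) (cu _ k * cx _ _) (cu _ k * cy _ _) (A * A0) (A * B0).
by move=> X1 X2 X3 X4 p1 p2 xx xy ux uy q1 q3 AA AA' BB'; split; lia.
Qed.

Lemma pow2_bounds_at0 s : exists c, pow2_bounds s 0 c c.
Proof.
exists (cx (f s) 0 + cu (f s) 0 + cy (f s) 0 + cv (f s) 0).
by split; apply: leq_trans (ltnW (ltn_pow2 _)) _; rewrite leq_exp2l //; lia.
Qed.

Lemma coefs_even0_growth : exists c, forall l k, k <= 2 ^ l ->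
  pow2_bounds 4 k ('C(k + c, 0) * (l + c)) ('C(k + c, 0) * (l + c) + l).
Proof.
have [c4 h4] := coefs4_growth; exists (c4 + 6) => l k kl; rewrite bin0 mul1n.
have [x y u v] := h4 k; have cc := ltn_pow2 c4; have l0 := expn_gt0 2 l.
have e1 : 2 ^ (l + (c4 + 6)) = 2 ^ l * (2 ^ c4 * 64) by rewrite !expnD.
have e2 : 2 ^ (l + (c4 + 6) + l) = 2 ^ l * 2 ^ l * (2 ^ c4 * 64) by rewrite expnD e1; lia.
rewrite /pow2_bounds e1 e2; move: (2 ^ l) (2 ^ c4) l0 kl cc => A D A0 kl cc.
rewrite -mulnn in y.
have h1 : c4 * k.+1 <= A * (D * 2) by nia.
have h2 : c4 * (k.+1 * k.+1) <= A * A * (D * 4).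
  have : k.+1 * k.+1 <= (2 * A) * (2 * A) by apply: leq_mul; lia.
  by move: (_ * k.+1) => K; nia.
have D0 : 0 < D by lia.
have : 64 <= A * (D * 64) by rewrite mulnA leq_pmull // muln_gt0 A0.
have : 64 <= A * A * (D * 64) by rewrite mulnA leq_pmull // !muln_gt0 A0.
by split; lia.
Qed.

Lemma coefs_odd1_growth : exists c, forall k,
  pow2_bounds 5 k 'C(k + c, 1) ('C(k + c, 1) + k).
Proof.
have [c5 h5] := coefs5_growth; exists c5 => k; rewrite bin1.
have [x y u v] := h5 k; have cc := ltn_pow2 c5; have kk := ltn_pow2 k.
rewrite /pow2_bounds !expnD; move: (2 ^ k) (2 ^ c5) kk cc x y u v => A D kA cD x y u v.
have h1 : c5 * k.+1 <= A * D by rewrite mulnC leq_mul // ltnW.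
split; first by apply: leq_trans x _; rewrite mulnC leq_mul2l ltnW ?orbT.
- exact: leq_trans u h1.
- by apply: leq_trans y _; rewrite leq_mul2r h1 orbT.
by apply: leq_trans v _; rewrite -mulnn mulnA leq_mul.
Qed.

(** At each level the exponent grows by the exponent for two intervals fewer, as in Pascal's rule,
    so two more intervals raise the lower index of the binomial by one. The shift [c] absorbs the
    constants; [l] stands for the logarithm of [k] and stays fixed during the induction on [k]. *)
Lemma coefs_parity_growth t :
  (exists c, forall l k, k <= 2 ^ l ->
     pow2_bounds t.*2.+4 k ('C(k + c, t) * (l + c)) ('C(k + c, t) * (l + c) + l)) /\
  (exists c, forall k,
     pow2_bounds t.*2.+4.+1 k 'C(k + c, t.+1) ('C(k + c, t.+1) + k)).
Proof.
elim: t => [|t [[c0 h0] [c1 h1]]].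
  by split; [exact: coefs_even0_growth | exact: coefs_odd1_growth].
have even : exists c, forall l k, k <= 2 ^ l ->
     pow2_bounds t.+1.*2.+4 k ('C(k + c, t.+1) * (l + c)) ('C(k + c, t.+1) * (l + c) + l).
  have [M hM] := pow2_bounds_at0 t.+1.*2.+4.
  pose c := c0 + c1 + M + t + 10; exists c => l.
  apply: (@pow2_bounds_next _ (2 ^ l) (fun k => 'C(k + c, t.+1) * (l + c))
    (fun k => 'C(k + c, t.+1) * (l + c) + l) (fun k => 'C(k + c0, t) * (l + c0))
    (fun k => 'C(k + c0, t) * (l + c0) + l) (fun k => 'C(k + c1, t.+1) + k)).
  - exact: h0.
  - by move=> k _; apply: pow2_boundsW (h1 k); rewrite ?leq_addr.
  - have : M <= 'C(0 + c, t.+1) * (l + c).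
      apply: (@leq_trans (l + c)); first by rewrite /c; lia.
      by rewrite leq_pmull // bin_gt0 /c; lia.
    by move=> le; apply: pow2_boundsW hM => //; apply: leq_trans le (leq_addr _ _).
  move=> k _.
  have b1 : 'C(k.+1 + c0, t) * (l + c0) + 2 <= 'C(k + c, t) * (l + c).
    have : 'C(k.+1 + c0, t) <= 'C(k + c, t) by apply: leq_bin2l; rewrite /c; lia.
    have : 0 < 'C(k + c, t) by rewrite bin_gt0 /c; lia.
    by rewrite /c; nia.
  have b2 : 'C(k.+1 + c1, t.+1) + k.+1 + 3 <= 'C(k.+1 + c, t.+1) * (l + c).
    have : 'C(k.+1 + c1, t.+1) <= 'C(k.+1 + c, t.+1) by apply: leq_bin2l; rewrite /c; lia.
    have : k.+1 <= 'C(k.+1 + c, t.+1).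
      by apply: ltnW; apply: leq_trans (bin_gt_sub _ _); rewrite // /c; lia.
    by rewrite /c; nia.
  have b3 : 'C(k.+1 + c, t.+1) * (l + c) = 'C(k + c, t.+1) * (l + c) + 'C(k + c, t) * (l + c).
    by rewrite addSn binS mulnDl.
  by split; lia.
split=> //; have [c2 h2] := even.
have [M hM] := pow2_bounds_at0 t.+1.*2.+4.+1.
have [c3 h3] := linear_up_log (2 * t.+2).
pose c := c1 + c2 + c3 + M + t + 10 + t.+2 * (c2 + 3); exists c => k.
apply: (@pow2_bounds_next _ k (fun k => 'C(k + c, t.+2)) (fun k => 'C(k + c, t.+2) + k)
  (fun k => 'C(k + c1, t.+1)) (fun k => 'C(k + c1, t.+1) + k)
  (fun k => 'C(k + c2, t.+1) * (up_log 2 k + c2) + up_log 2 k)) => //.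
- move=> {}k _; have := h2 (up_log 2 k) k (up_logP _ (isT : 1 < 2)).
  by apply: pow2_boundsW; rewrite ?leq_addr.
- have : M <= 'C(0 + c, t.+2).
    by apply: ltnW; apply: leq_trans (bin_gt_sub _ _); rewrite // /c; lia.
  by move=> le; apply: pow2_boundsW hM => //; apply: leq_trans le (leq_addr _ _).
move=> {}k _.
have b1 : 'C(k.+1 + c1, t.+1) + 2 <= 'C(k + c, t.+1).
  apply: leq_trans (_ : 'C(k + c - 2, t.+1) + 2 <= _).
    by rewrite leq_add2r leq_bin2l // /c; lia.
  have -> : k + c = (k + c - 2).+2 by rewrite /c; lia.
  by rewrite !subSS subn0 bin_add2 // /c; lia.
(* ['C(k.+1 + c, t.+2)] is ['C(k + c, t.+1)] times [(k.+1 + c) / t.+2], which exceeds the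
   logarithmic factor by the choice of [c3] and [c]. *)
have b2 : 'C(k.+1 + c2, t.+1) * (up_log 2 k.+1 + c2) + up_log 2 k.+1 + 3 <= 'C(k.+1 + c, t.+2).
  have le : 'C(k.+1 + c2, t.+1) <= 'C(k + c, t.+1) by apply: leq_bin2l; rewrite /c; lia.
  have := h3 k.+1; move: (up_log 2 k.+1) => l hl.
  rewrite -(leq_pmul2l (ltn0Sn t.+1)) addSn -mul_bin_diag.
  apply: leq_trans (_ : (2 * t.+2 * l + t.+2 * (c2 + 3)) * 'C(k + c, t.+1) <= _); last first.
    by rewrite leq_mul2r; apply/orP; right; rewrite /c; lia.
  have : 0 < 'C(k + c, t.+1) by rewrite bin_gt0 /c; lia.
  move: ('C(_, _)) ('C(_, _)) le => X Y; clear; nia.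
have b3 : 'C(k.+1 + c, t.+2) = 'C(k + c, t.+2) + 'C(k + c, t.+1) by rewrite addSn binS.
by split; lia.
Qed.

End Growth.

(** * Traces of a family of permutations *)

Lemma card_imset_factor (T U V : finType) (A : {set T}) (h : T -> U) (t : T -> V) :
  {in A &, forall x y, h x = h y -> t x = t y} -> #|t @: A| <= #|h @: A|.
Proof.
move=> ht; have [->|/set0Pn[x0 x0A]] := eqVneq A set0; first by rewrite !imset0 !cards0.
pose g u := t (odflt x0 [pick x in A | h x == u]).
apply: leq_trans (leq_imset_card g (h @: A)).
apply/subset_leq_card/subsetP => _ /imsetP[x xA ->].
apply/imsetP; exists (h x); first exact: imset_f.
rewrite /g; case: pickP => [y /andP[yA /eqP hy] /=|/(_ x)]; first exact: ht.
by rewrite xA eqxx.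
Qed.

Section Traces.
Variable n : nat.
Implicit Types (P : {set 'S_n}) (D : {set 'I_n * 'I_n}) (K : {set 'I_n}).

Definition trace D (p : 'S_n) := [set x in D | x.2 < p x.1].
Definition traces P D := trace D @: P.

(** If [p i < q i], then the cut [(i, p i)] lies in the trace of [q] only. *)
Lemma traces_setT P : #|traces P setT| = #|P|.
Proof.
rewrite card_in_imset // => p q _ _ /setP epq; apply/permP => i; apply/val_inj => /=.
have := epq (i, p i); have := epq (i, q i); rewrite !inE /= !ltnn.
by case: ltngtP.
Qed.

Definition column D i := [set c | (i, c) \in D].

Lemma sum_card_column D : \sum_i #|column D i| = #|D|.
Proof.
rewrite -[RHS]sum1_card (eq_bigr (fun i => \sum_(c | (i, c) \in D) 1)); last first.
  by move=> i _; rewrite sum1dep_card.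
by rewrite pair_big_dep /=; apply: eq_bigl => -[].
Qed.

(** In each column a trace is an initial segment of the cuts, determined by its size. A column with
    [d] cuts allows at most [d + 1 <= X * 2 ^ (d %/ X)] sizes, and these exponents sum to at most
    [n]. *)
Lemma leq_card_traces P D X : 0 < X -> #|D| <= n * X -> #|traces P D| <= (2 * X) ^ n.
Proof.
move=> X0 DX; pose d i := #|column D i|.
pose cnt (p : 'S_n) := [ffun i => inord #|[set c in column D i | c < p i]| : 'I_n.+1].
have cntE p i : cnt p i = #|[set c in column D i | c < p i]| :> nat.
  by rewrite ffunE inordK // ltnS -[X in _ <= X](card_ord n) max_card.
apply: (@leq_trans #|cnt @: P|).
  apply: card_imset_factor => p q _ _ /ffunP epq; apply/setP => -[i c]; rewrite !inE /=.
  have [iD /=|//] := boolP ((i, c) \in D).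
  wlog le : p q epq / p i <= q i => [W|].
    by have [/W ->|/ltnW /W <-] := leqP (p i) (q i).
  have sub : [set c in column D i | c < p i] \subset [set c in column D i | c < q i].
    by apply/subsetP => b; rewrite !inE => /andP[-> bp]; apply: leq_trans le.
  have /eqP/setP/(_ c) : [set c in column D i | c < p i] == [set c in column D i | c < q i].
    by rewrite eqEcard sub -!cntE epq /=.
  by rewrite !inE iD.
pose F i := [pred j : 'I_n.+1 | j <= d i].
have cF i : #|F i| <= (d i).+1.
  rewrite cardE -(size_map val) -[X in _ <= X](size_iota 0); apply: uniq_leq_size.
    by rewrite map_inj_uniq ?enum_uniq //; apply: val_inj.
  by move=> _ /mapP[j + ->]; rewrite mem_enum mem_iota inE.
apply: (@leq_trans #|family F|).
  apply/subset_leq_card/subsetP => _ /imsetP[p pP ->]; apply/familyP => i.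
  by rewrite inE cntE; apply/subset_leq_card/subsetP => c; rewrite inE => /andP[].
rewrite card_family.
have -> : foldr muln 1 [seq #|F x| | x : 'I_n] = \prod_(i < n) #|F i|.
  have prodE l : foldr muln 1 l = \prod_(m <- l) m.
    by elim: l => [|m l /= ->]; rewrite ?big_nil ?big_cons.
  by rewrite prodE big_image.
apply: (@leq_trans (\prod_(i < n) (X * 2 ^ (d i %/ X)))).
  apply: leq_prod => i _; apply: leq_trans (cF i) _.
  apply: leq_trans (ltn_ceil (d i) X0) _; rewrite mulnC leq_mul2l; apply/orP; right.
  exact: ltn_expl.
rewrite big_split /= prod_nat_const card_ord expnMn mulnC leq_mul2r; apply/orP; right.
rewrite -expn_sum leq_exp2l // -(leq_pmul2r X0) big_distrl /=; apply: leq_trans DX.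
by rewrite -sum_card_column; apply: leq_sum => i _; apply: leq_trunc_div.
Qed.

Definition cell D (U : pred 'I_n) i := [set c in column D i | U c].

(** * Removing redundant cuts *)

Section Removal.
Variables (P : {set 'S_n}) (s : nat) (U : 'I_s -> pred 'I_n).
Hypothesis s_gt1 : 1 < s.
Hypothesis noshatter : forall a : s.-tuple 'I_n, increasing a -> ~~ shatters P a.
Hypothesis U_ltn : forall (t t' : 'I_s) (c c' : 'I_n), t < t' -> U t c -> U t' c' -> c < c'.

(** The value at [i] then lies above the cut [c] but not above [c'], hence between two cuts of the
    value interval [t]. *)
Definition crosses D (tau : {set 'I_n * 'I_n}) i (t : 'I_s) :=
  [exists c, exists c', [&& c \in cell D (U t) i, c' \in cell D (U t) i,
    (i, c) \in tau & (i, c') \notin tau]].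

(** Prescribing the interval [q j] at the [j]-th column of [L] forces the restriction to be [q],
    because the intervals are ordered; so [L] would be shattered. *)
Lemma crosses_not_realized D (L : {set 'I_n}) :
  #|L| = s -> ~~ realizes (crosses D) (traces P D) L.
Proof.
move=> cL; apply/negP => /realizesP rL.
have sz : size (enum L) == s by rewrite -cardE cL.
pose a := Tuple sz.
have inc : increasing a.
  rewrite /increasing /=; apply: (subseq_sorted ltn_trans) (iota_ltn_sorted 0 n).
  by rewrite -val_enum_ord map_subseq // enumT; apply: filter_subseq.
have /negP := noshatter inc; apply; apply/forallP => q; apply/exists_inP.
have anth (j : 'I_s) : tnth a j = nth (tnth a j) (enum L) j by exact: tnth_nth.
(* A column outside of [L] has index [s], which is out of range, and gets a default letter. *)
pose phi := [ffun i => if insub (index i (enum L)) is Some j then q j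
  else q (Ordinal (ltnW s_gt1))].
have phiE j : phi (tnth a j) = q j.
  rewrite ffunE {1}anth index_uniq ?enum_uniq ?(eqP sz) //.
  by rewrite valK.
have [tau /imsetP[p pP ->] H] := rL phi; exists p => //.
have mem j : tnth a j \in L by rewrite -mem_enum mem_tnth.
have ltq i j : q i < q j -> p (tnth a i) < p (tnth a j).
  move=> qij.
  have /existsP[c /existsP[c' /and4P[_ c'U _ c'p]]] := H _ (mem i).
  have /existsP[b /existsP[b' /and4P[bU _ bp _]]] := H _ (mem j).
  move: c'U c'p bU bp; rewrite !phiE !inE /= => /andP[iD c'U];
    rewrite iD /= -leqNgt => le /andP[_ bU] /andP[_ lt].
  by apply: leq_ltn_trans le (ltn_trans _ lt); apply: U_ltn qij c'U bU.
apply/forallP => i; apply/forallP => j; apply/eqP.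
have [/ltq -> //|/ltq|/val_inj/perm_inj ->] := ltngtP (q i) (q j); last by rewrite ltnn.
by case: ltngtP.
Qed.

(* If a trace does not cross [U (t i)] at column [i], then it is constant on the
   cuts of that cell, which its value at the first of them thus determines. *)
Lemma removal_step D K B c (W := s * (c * s + 1)) :
  P != set0 -> #|K| = 2 ^ c -> 2 * W <= 2 ^ c ->
  (forall i t, i \in K -> B <= #|cell D (U t) i|) -> 0 < B ->
  exists2 D' : {set 'I_n * 'I_n}, D' \subset D & 2 ^ c * B.-1 <= 2 * #|D :\: D'| /\
    #|traces P D| <= 2 ^ (c.+1 * W).+1 * #|traces P D'|.
Proof.
move=> P0 cK hW hB B0.
have G0 : traces P D != set0.
  by case/set0Pn: P0 => p pP; apply/set0Pn; exists (trace D p); apply: imset_f.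
have [K0 [t [G' [sK sG av cK0 cG]]]] := avoiding_subfamily_pow2 s_gt1 cK hW G0
   (fun L _ cL => crosses_not_realized D cL).
pose J i := cell D (U (t i)) i.
(* The cuts to remove: all but the first of the avoided cell, in each column of [K0]. *)
pose R := [set x in D | [&& x.1 \in K0, x.2 \in J x.1 & [exists c0 in J x.1, c0 < x.2]]].
have RD : R \subset D by apply/subsetP => x; rewrite inE => /andP[].
have low i : i \in K0 -> exists2 c0, c0 \in J i & forall c1, c1 \in J i -> c0 <= c1.
  move=> iK0; have /card_gt0P[x xJ] : 0 < #|J i|.
    by apply: leq_trans B0 (hB i (t i) _); apply: (subsetP sK).
  by case: (arg_minnP (fun c1 : 'I_n => c1 : nat) xJ) => c0 c0J c0min; exists c0.
exists (D :\: R); first exact: subsetDl.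
have DDR : D :\: (D :\: R) = R by rewrite setDDr setDv set0U (setIidPr RD).
rewrite DDR; split.
  apply: leq_trans (leq_mul cK0 (leqnn _)) _; rewrite -mulnA leq_mul2l /=.
  rewrite -sum_card_column -sum_nat_const [X in _ <= X](bigID (mem K0)) /=.
  apply: leq_trans (leq_addr _ _); apply: leq_sum => i iK0.
  have [c0 c0J c0min] := low i iK0.
  have -> : column R i = J i :\ c0.
    apply/setP => c1; rewrite [LHS]inE [LHS]inE /= iK0 [RHS]inE in_set1.
    have [c1J|c1J] := boolP (c1 \in J i); rewrite ?andbF //= andbT.
    have -> /= : (i, c1) \in D by move: c1J; rewrite !inE => /andP[].
    have le := c0min _ c1J; apply/exists_inP/idP => [[c2 c2J lt]|ne].
      by apply: contraTneq lt => ->; rewrite -leqNgt c0min.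
    by exists c0 => //; rewrite ltn_neqAle le andbT eq_sym.
  have := hB i (t i) (subsetP sK _ iK0); rewrite -/(J i) (cardsD1 c0) c0J add1n.
  by case: (B).
apply: leq_trans cG _; rewrite leq_mul2l; apply/orP; right.
pose h (tau : {set 'I_n * 'I_n}) := tau :&: (D :\: R).
have hI : {in G' &, injective h}.
  have const tau i c0 c1 : tau \in G' -> i \in K0 -> c0 \in J i -> c1 \in J i ->
      (i, c0) \in tau -> (i, c1) \in tau.
    move=> tG iK0 c0J c1J c0t; apply: contraT => c1t; have /negP := av tau i tG iK0; case.
    by apply/existsP; exists c0; apply/existsP; exists c1; rewrite c0J c1J c0t.
  have sub tau1 tau2 : tau1 \in G' -> tau2 \in G' -> h tau1 = h tau2 -> tau1 \subset tau2.
    move=> t1G t2G eh; apply/subsetP => -[i c1] x1.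
    have xD : (i, c1) \in D.
      by have /imsetP[p _ etau] := subsetP sG _ t1G; move: x1; rewrite etau inE => /andP[].
    have [xR|xR] := boolP ((i, c1) \in R); last first.
      have : (i, c1) \in h tau1 by rewrite in_setI x1 in_setD xR.
      by rewrite eh in_setI => /andP[].
    have /and3P[_ iK0 /andP[c1J _]] :
      [&& (i, c1) \in D, i \in K0 & (c1 \in J i) && [exists c0 in J i, c0 < c1]].
      by move: xR; rewrite [_ \in R]inE.
    have [c0 c0J c0min] := low i iK0.
    apply: (const _ i c0) => //.
    have c0R : (i, c0) \notin R.
      rewrite inE /= iK0 c0J /= negb_and; apply/orP; right.
      by apply/exists_inPn => c2 c2J; rewrite -leqNgt c0min.
    have c0D : (i, c0) \in D by move: c0J; rewrite !inE => /andP[].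
    have : (i, c0) \in h tau1 by rewrite in_setI (const _ i c1) // in_setD c0R.
    by rewrite eh in_setI => /andP[].
  by move=> tau1 tau2 t1 t2 eh; apply/eqP; rewrite eqEsubset !sub.
rewrite -(card_in_imset hI); apply/subset_leq_card/subsetP => _ /imsetP[tau tG ->].
have /imsetP[p pP ->] := subsetP sG _ tG.
apply/imsetP; exists p => //; apply/setP => x; rewrite !in_set.
by case: (x \in D); rewrite ?andbF //= andbT andbC.
Qed.

End Removal.
End Traces.

(** * Grouping the values into rows *)

Section Grouping.
Variables (n B : nat) (D : {set 'I_n * 'I_n}).
Hypothesis B_gt0 : 0 < B.

Definition grouped i y := #|[set c in column D i | c %/ B == y]|.

Lemma weight_grouped i p q :
  weight grouped i p q = #|[set c in column D i | p <= c %/ B < q]|.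
Proof.
rewrite /weight (eq_bigr (fun y => \sum_(c in column D i) (c %/ B == y))); last first.
  by move=> y _; rewrite /grouped -sum1dep_card -big_mkcondr.
rewrite exchange_big /= -sum1dep_card [RHS]big_mkcondr /=; apply: eq_bigr => c _.
case: ifP => [pcq|npq].
  rewrite (bigD1_seq (c %/ B)) ?iota_uniq ?mem_index_iota //= eqxx big1 // => y.
  by rewrite eq_sym; case: eqP.
by rewrite big_nat big1 // => y pyq; case: eqP => // e; rewrite e pyq in npq.
Qed.

Lemma grouped_leq i y : grouped i y <= B.
Proof.
have h : {in [set c in column D i | c %/ B == y] &,
  injective (fun c : 'I_n => Ordinal (ltn_pmod c B_gt0))}.
  move=> c c'; rewrite !inE => /andP[_ /eqP cy] /andP[_ /eqP cy'] [e].
  by apply/val_inj; rewrite /= (divn_eq c B) (divn_eq c' B) cy cy' e.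
by rewrite /grouped -(card_in_imset h) -[X in _ <= X](card_ord B) max_card.
Qed.

Lemma grouped0 i y : n %/ B < y -> grouped i y = 0.
Proof.
move=> ny; apply/eqP; rewrite cards_eq0; apply/eqP/setP => c; rewrite !inE.
by apply/negP => /andP[_ /eqP e]; have := leq_div2r B (ltnW (ltn_ord c)); lia.
Qed.

Lemma sum_weight_grouped : \sum_i weight grouped i 0 (n %/ B).+1 = #|D|.
Proof.
rewrite -sum_card_column; apply: eq_bigr => i _; rewrite weight_grouped.
apply: eq_card => c; rewrite !inE /= ltnS leq_div2r ?andbT //; exact: ltnW.
Qed.

(** This is [bounds_coefs] with [L = B], as a row holds at most [B] values, and with [j = 3], the
    threshold in the definition of [alpha]; hence [4 ^ s]. The double negation comes from the
    negated formation in [weight_bound]. *)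
Lemma formation_of_many_cuts e s k r : 0 < s -> 2 * s + 2 <= e -> n <= ack k.+1 3 ->
  (cx (coefs_of e s) k + cy (coefs_of e s) k) * B * n +
  r * ((cu (coefs_of e s) k + cv (coefs_of e s) k) * B * 4 ^ s) * (n %/ B).+1 < #|D| ->
  ~ ~ formation B r s grouped [set: 'I_n].
Proof.
move=> s0 se nk lt nF.
have := @bounds_coefs e s s0 se _ B r k 3 B B_gt0 grouped setT (n %/ B).+1 0 (n %/ B).+1
   grouped_leq _ _ _ _ _ nF.
rewrite (eq_bigl xpredT) => [|i]; last by rewrite inE.
rewrite sum_weight_grouped cardsT card_ord subn0 -(mulnDl (cx _ _)) -(mulnDl (cu _ _)) => h.
move: lt; rewrite ltnNge h ?leqnn //.
- by move=> i y; apply: grouped0.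
- apply: leq_trans (_ : 2 * ack k.+1 3 <= _).
    by have := leq_div n B; have := ackS_gt0 k 3; lia.
  apply: leq_trans (_ : ack k.+1 3 ^ 2 <= _).
    by rewrite -mulnn leq_mul2r ltnW ?orbT // (ltn_trans _ (ack_gt _ _)).
  by rewrite leq_pexp2l ?ackS_gt0 //; lia.
- by move=> i _; rewrite weight_nil.
- by move=> i _; rewrite weight_nil.
Qed.

End Grouping.

(** * Counting the permutations by phases of removals *)

Section Counting.
Variables (n s : nat) (P : {set 'S_n}).
Hypothesis s_gt1 : 1 < s.
Hypothesis noshatter : forall a : s.-tuple 'I_n, increasing a -> ~~ shatters P a.
Hypothesis P_neq0 : P != set0.
Implicit Types (D : {set 'I_n * 'I_n}).

Lemma removal_of_formation D B c (W := s * (c * s + 1)) : 1 < B -> 2 * W <= 2 ^ c ->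
  formation B (2 ^ c) s (grouped B D) [set: 'I_n] ->
  exists2 D' : {set 'I_n * 'I_n}, D' \subset D & 2 ^ c * B <= 4 * #|D :\: D'| /\
    #|traces P D| <= 2 ^ (c.+1 * W).+1 * #|traces P D'|.
Proof.
move=> B1 hW [y0 [ys [sys cK]]]; have B0 := ltnW B1.
set K1 := [set i in _ | _] in cK.
have [K KK1 cardK] : exists2 K : {set 'I_n}, K \subset K1 & #|K| = 2 ^ c.
  have : 0 < #|[set A : {set 'I_n} | (A \subset K1) & #|A| == 2 ^ c]|.
    by rewrite cards_draws bin_gt0.
  by case/card_gt0P => K; rewrite inE => /andP[sK /eqP eK]; exists K.
have K1P i : i \in K -> forall t, t < s ->
    B <= weight (grouped B D) i (nth 0 (y0 :: ys) t) (nth 0 ys t).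
  move=> /(subsetP KK1); rewrite inE => /andP[_ /(pathP 0) h] t ts.
  by apply: h; rewrite sys.
have K0 : K != set0 by rewrite -card_gt0 cardK expn_gt0.
have [i0 i0K] := set0Pn _ K0.
have srt : sorted leq (y0 :: ys).
  apply/(pathP 0) => t; rewrite sys => ts; apply: ltnW.
  by apply: (@weight_ltn _ (grouped B D) i0); apply: leq_trans (K1P _ i0K t ts).
pose U (t : 'I_s) := [pred c : 'I_n | nth 0 (y0 :: ys) t <= c %/ B < nth 0 ys t].
have U_ltn (t t' : 'I_s) (x x' : 'I_n) : t < t' -> U t x -> U t' x' -> x < x'.
  move=> tt /andP[_ xt] /andP[tx _].
  have : nth 0 ys t <= nth 0 (y0 :: ys) t'.
    have := sorted_leq_nth leq_trans leqnn 0 srt t.+1 t'; rewrite /= !inE sys !ltnS.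
    by apply => //; apply: ltnW.
  move=> le; rewrite ltnNge; apply/negP => /(leq_div2r B) le2.
  by have := leq_trans (leq_trans xt le) tx; rewrite ltnNge le2.
have [D' sD [h1 h2]] := @removal_step n P s U s_gt1 noshatter U_ltn D K B c P_neq0 cardK hW
   (fun i t iK => leq_trans (K1P i iK t (ltn_ord t)) (eq_leq (weight_grouped _ _ _ _ _))) B0.
exists D' => //; split=> //.
by have := leq_mul (leqnn 2) h1; move: h1; move: (2 ^ c) => X; nia.
Qed.

Variables (k p p' : nat).
Local Notation f := (coefs_of (2 * s + 2) s).
Hypothesis n_ack : n <= ack k.+1 3.
Hypothesis P_pow2 : cx f k + cy f k <= 2 ^ p.
Hypothesis Q_pow2 : 2 * 4 ^ s * (cu f k + cv f k) <= 2 ^ p'.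

Lemma removal b D (c := p + b) (W := s * (c * s + 1)) :
  0 < p' + b -> 2 * W <= 2 ^ c -> n * 2 ^ (p + p' + b + 1) < #|D| ->
  exists2 D' : {set 'I_n * 'I_n}, D' \subset D & 2 ^ (p + p' + 2 * b) <= 4 * #|D :\: D'| /\
    #|traces P D| <= 2 ^ (c.+1 * W).+1 * #|traces P D'|.
Proof.
(* This [B] balances the column term and the row term: each is at most [n * 2 ^ (p + p' + b)]. *)
move=> b0 hW big; set B := 2 ^ (p' + b).
have B1 : 1 < B by rewrite /B -{1}(expn0 2) ltn_exp2l.
have e2 : 2 ^ (p + p' + 2 * b) = 2 ^ c * B by rewrite -expnD; congr (2 ^ _); rewrite /c; lia.
have eX : 2 ^ (p + p' + b + 1) = 2 ^ p * B + 2 ^ p' * 2 ^ c.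
  have -> : p + p' + b + 1 = (p + (p' + b)).+1 by lia.
  by rewrite expnS mul2n -addnn /B /c -!expnD; congr (2 ^ _ + 2 ^ _); lia.
(* A boolean goal can be derived from a doubly negated formation. *)
pose goal := [exists D' : {set 'I_n * 'I_n}, [&& D' \subset D,
  2 ^ (p + p' + 2 * b) <= 4 * #|D :\: D'| &
    #|traces P D| <= 2 ^ (c.+1 * W).+1 * #|traces P D'|]].
suff /existsP[D' /and3P[]] : goal by exists D'.
have [//|ngoal] := boolP goal; exfalso.
apply: (@formation_of_many_cuts n B D (ltnW B1) (2 * s + 2) s k (2 ^ c) (ltnW s_gt1) (leqnn _)
  n_ack); last first.
  move=> F; have [D' sD [h1 h2]] := removal_of_formation B1 hW F.
  by case/negP: ngoal; apply/existsP; exists D'; rewrite sD e2 h1.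
apply: leq_ltn_trans (big); rewrite eX mulnDr.
have Dn : #|D| <= n * n by have := max_card (mem D); rewrite card_prod card_ord.
(* There are at most [n * n] cuts, so having many of them bounds [B]; then the incomplete last row
   at most doubles the count of rows. *)
have Bn : B <= n.
  have : n * (2 ^ p * B + 2 ^ p' * 2 ^ c) < n * n by rewrite -eX; apply: leq_trans big Dn.
  rewrite ltn_mul2l => /andP[_]; have := expn_gt0 2 p; move: (2 ^ p) => X; nia.
have nB : (n %/ B).+1 * B <= 2 * n by have := leq_trunc_div n B; lia.
apply: leq_add; first by rewrite mulnC leq_mul2l leq_mul2r P_pow2 !orbT.
move: Q_pow2 nB; move: (2 ^ c) (2 ^ p') (cu f k + cv f k) ((n %/ B).+1) (4 ^ s) => C Q q M F H' nB.
have := leq_mul H' (leqnn (C * n)); have := leq_mul nB (leqnn (C * (q * F))); nia.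
Qed.

Let lam b := (p + b).+1 * (s * ((p + b) * s + 1)) + 1.

(* Each removal deletes [2 ^ (p + p' + 2 * b) / 4] cuts, so that about [n / 2 ^ b]
   removals, each with a loss of [lam b] bits, halve the bound on [#|D|]. *)
Lemma phase b D : 0 < p' + b -> 2 * (s * ((p + b) * s + 1)) <= 2 ^ (p + b) ->
  #|D| <= n * 2 ^ (p + p' + b + 2) ->
  exists tau (D' : {set 'I_n * 'I_n}), [/\ #|D'| <= n * 2 ^ (p + p' + b + 1),
    tau * 2 ^ b <= 9 * n & #|traces P D| <= 2 ^ (lam b * tau) * #|traces P D'|].
Proof.
move=> b0 hW Dle.
have iter tau : forall D, 4 * #|D| <= 4 * n * 2 ^ (p + p' + b + 1) + tau * 2 ^ (p + p' + 2 * b) ->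
    exists2 D' : {set 'I_n * 'I_n}, #|D'| <= n * 2 ^ (p + p' + b + 1) &
      #|traces P D| <= 2 ^ (lam b * tau) * #|traces P D'|.
  elim: tau => [|tau IH] E leE.
    by exists E; rewrite ?muln0 ?mul1n // -(leq_pmul2l (isT : 0 < 4)); lia.
  have [small|big] := leqP #|E| (n * 2 ^ (p + p' + b + 1)).
    by exists E => //; rewrite leq_pmull ?expn_gt0.
  have [E' sE [h1 h2]] := removal b0 hW big.
  have cE : #|E| = #|E'| + #|E :\: E'| by rewrite -(cardsID E' E) (setIidPr sE).
  have [|D' D'le h3] := IH E'; first by lia.
  exists D' => //; apply: leq_trans h2 _; rewrite mulnS [2 ^ (_ + _)]expnD -mulnA.
  by apply: leq_mul h3; rewrite /lam [X in _ <= 2 ^ X]addn1.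
have [small|big] := leqP #|D| (n * 2 ^ (p + p' + b + 1)).
  by exists 0, D; rewrite muln0 mul1n.
have bn : 2 ^ b <= n.
  have Dn : #|D| <= n * n by have := max_card (mem D); rewrite card_prod card_ord.
  have := leq_trans big Dn; rewrite ltn_mul2l => /andP[_ /ltnW]; apply: leq_trans.
  by rewrite leq_exp2l //; lia.
(* The bound on [4 * #|D|] has to drop by [8 * n * 2 ^ (p + p' + b)], and a removal contributes
   [2 ^ b * 2 ^ (p + p' + b)]. The added 1 fits into [9 * n] because [2 ^ b <= n]. *)
pose tau := (8 * n) %/ 2 ^ b + 1.
have tau_ge : 8 * n <= tau * 2 ^ b.
  by rewrite /tau addn1 ltnW // ltn_ceil // expn_gt0.
have tau_le : tau * 2 ^ b <= 9 * n.
  by have := leq_trunc_div (8 * n) (2 ^ b); rewrite /tau mulnDl; lia.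
have [|D' h1 h2] := iter tau D; last by exists tau, D'.
have e1 : 2 ^ (p + p' + b + 2) = 4 * 2 ^ (p + p' + b) by rewrite addn2 !expnS; lia.
have e2 : 2 ^ (p + p' + b + 1) = 2 * 2 ^ (p + p' + b) by rewrite addn1 expnS.
have e3 : 2 ^ (p + p' + 2 * b) = 2 ^ b * 2 ^ (p + p' + b) by rewrite -expnD; congr (2 ^ _); lia.
move: Dle; rewrite e1 e2 e3; have := leq_mul tau_ge (leqnn (2 ^ (p + p' + b))).
by move: (2 ^ b) (2 ^ (p + p' + b)) => X Y; nia.
Qed.

(* A potential: by [lam_quad], [quad b / 2 ^ b] bounds the sum of [lam b' / 2 ^ b']
   over all phases [b' >= b], up to a constant. *)
Let quad b := let z := p + b + 2 in s ^ 2 * (z ^ 2 + 2 * z + 3).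

Lemma lam_quad b : lam b + quad b.+1 <= 2 * quad b.
Proof.
have : lam b <= s ^ 2 * (p + b + 2) ^ 2.
  rewrite /lam -!mulnn; move: (p + b) => c; nia.
rewrite /quad -!mulnn; move: (lam b) => l; nia.
Qed.

Variable b0 : nat.
Hypothesis quad_b0 : quad b0 <= 2 ^ b0.

Lemma quad_W d : 2 * (s * ((p + (b0 + d)) * s + 1)) <= 2 ^ (p + (b0 + d)).
Proof.
apply: leq_trans (_ : 2 ^ (b0 + d) <= _); last by rewrite leq_exp2l ?leq_addl.
suff : 2 * (s ^ 2 * (p + (b0 + d) + 1)) <= 2 ^ (b0 + d).
  by apply: leq_trans; rewrite -mulnn; nia.
elim: d => [|d IH].
  by rewrite addn0; apply: leq_trans quad_b0; rewrite /quad -!mulnn; nia.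
have : 2 * s ^ 2 <= 2 ^ (b0 + d) by apply: leq_trans IH; rewrite -mulnn; nia.
rewrite [b0 + d.+1]addnS [2 ^ (b0 + d).+1]expnS; move: IH; move: (s ^ 2) (2 ^ (b0 + d)) => X T; nia.
Qed.

(** The power [2 ^ (b0 + d)] clears denominators: [Y / 2 ^ (b0 + d)] is the number of bits per
    column. The base case counts traces directly, and each step prepends one phase. *)
Lemma traces_bound d : exists2 Y, Y + 18 * quad (b0 + d) <=
    2 ^ d * (2 ^ b0 * (p + p' + b0 + 2) + 18 * quad b0) &
  forall D, #|D| <= n * 2 ^ (p + p' + (b0 + d) + 1) ->
    #|traces P D| ^ 2 ^ (b0 + d) <= 2 ^ (n * Y).
Proof.
have b1 : 0 < b0 by move: quad_b0; rewrite /quad -!mulnn; case: (b0) => //; rewrite expn0; nia.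
elim: d => [|d [Y hY IH]].
  exists (2 ^ b0 * (p + p' + b0 + 2)); rewrite addn0 ?mul1n // => D Dle.
  have := @leq_card_traces n P D (2 ^ (p + p' + b0 + 1)) _ Dle; rewrite expn_gt0 => /(_ isT) h.
  rewrite -(leq_exp2r _ _ (_ : 0 < 2 ^ b0)) ?expn_gt0 // in h; apply: leq_trans h _.
  by rewrite -expnS -!expnM leq_exp2l //; lia.
(* The constant 18 is the 9 of [phase], doubled by squaring. *)
exists (2 * Y + 18 * lam (b0 + d)).
  have := lam_quad (b0 + d); rewrite -addnS expnS; lia.
move=> D Dle.
have [||tau [D' [h1 h2 h3]]] := @phase (b0 + d) D _ (quad_W d).
- by rewrite addnA addn_gt0 addn_gt0 b1 orbT.
- by apply: leq_trans Dle _; rewrite leq_mul2l leq_exp2l //; lia.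
rewrite addnS expnS mulnC expnM; have := IH D' h1.
rewrite -(leq_exp2r _ _ (_ : 0 < 2 ^ (b0 + d))) ?expn_gt0 // in h3.
rewrite expnMn -expnM -mulnA in h3.
move=> h4; rewrite (@leq_trans ((2 ^ (lam (b0 + d) * (9 * n)) * 2 ^ (n * Y)) ^ 2)) //.
  rewrite leq_exp2r //; apply: leq_trans h3 _; apply: leq_mul => //.
  by rewrite leq_exp2l // leq_mul2l h2 orbT.
by rewrite -expnD -expnM leq_exp2l //; lia.
Qed.

Lemma card_leq_pow2 : #|P| <= 2 ^ (n * (p + p' + b0 + 20)).
Proof.
(* As [n <= 2 ^ n], [n] phases reach the set of all [n * n] cuts. The constant 20 of the claim is
   [2 + 18]. *)
have [Y hY H] := traces_bound n.
have := H setT; rewrite cardsT card_prod !card_ord traces_setT.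
have nn : n * n <= n * 2 ^ (p + p' + (b0 + n) + 1).
  rewrite leq_mul2l; apply/orP; right; apply: leq_trans (ltnW (ltn_expl n (isT : 1 < 2))) _.
  by rewrite leq_exp2l //; lia.
move=> /(_ nn) h; rewrite -(leq_exp2r _ _ (_ : 0 < 2 ^ (b0 + n))) ?expn_gt0 //.
apply: leq_trans h _; rewrite -expnM leq_exp2l // -mulnA leq_mul2l; apply/orP; right.
apply: leq_trans (leq_trans (leq_addr _ _) hY) _.
rewrite [b0 + n]addnC expnD [X in _ <= X]mulnC -mulnA leq_mul2l; apply/orP; right.
by move: quad_b0; move: (2 ^ b0) (quad b0) => X Z; nia.
Qed.

End Counting.

(** * Bounds in terms of the inverse Ackermann function *)

Lemma VCdim_noshatter n k (P : {set 'S_n}) (a : k.+1.-tuple 'I_n) :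
  VCdim P = k -> increasing a -> ~~ shatters P a.
Proof.
move=> dP inc; apply/negP => sh.
have kn : k.+1 < n.+1.
  have /(uniq_leq_size (s1 := [seq val i | i <- a])) h : uniq [seq val i | i <- a].
    by apply: sorted_uniq inc; [exact: ltn_trans | exact: ltnn].
  have := h (iota 0 n); rewrite size_map size_tuple size_iota => /(_ _); apply.
  by move=> _ /mapP[i _ ->]; rewrite mem_iota /= add0n.
suff : k.+1 <= VCdim P by rewrite dP ltnn.
apply: (@leq_bigmax_cond _ _ (fun k : 'I_n.+1 => k : nat) (Ordinal kn)).
by apply/existsP; exists a; rewrite inc.
Qed.

Lemma quadratic_leq_pow2 M : exists c, M * (c + 5) ^ 2 <= 2 ^ c.
Proof.
exists (4 * (25 * M)); move: (ltn_expl (25 * M) (isT : 1 < 2)).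
have -> : 2 ^ (4 * (25 * M)) = 2 ^ (25 * M) * 2 ^ (25 * M) * (2 ^ (25 * M) * 2 ^ (25 * M)).
  by rewrite -!expnD; congr (2 ^ _); lia.
move: (2 ^ _) => X h; rewrite -mulnn.
have : 25 * M * ((25 * M).+1 * (25 * M).+1) <= X * X * (X * X).
  by apply: leq_mul; [nia | apply: leq_mul].
nia.
Qed.

Lemma r_vc_leq_pow2 s : 1 < s -> exists c, forall n k p p',
  n <= ack k.+1 3 -> 0 < p ->
  cx (coefs_of (2 * s + 2) s) k + cy (coefs_of (2 * s + 2) s) k <= 2 ^ p ->
  cu (coefs_of (2 * s + 2) s) k + cv (coefs_of (2 * s + 2) s) k <= 2 ^ p' ->
  r_vc s.-1 n <= 2 ^ (n * (p + p' + 2 * up_log 2 p + c)).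
Proof.
case: s => // m s1; set s := m.+1; have [c hc] := quadratic_leq_pow2 (s ^ 2 * 6).
exists (2 * s + 1 + c + 20) => n k p p' nk p0 hp hp'.
apply/bigmax_leqP => P /eqP dP.
have [->|P0] := eqVneq P set0; first by rewrite cards0.
have nosh (a : s.-tuple 'I_n) : increasing a -> ~~ shatters P a.
  exact: VCdim_noshatter.
pose l := up_log 2 p; have pl : p <= 2 ^ l by apply: up_logP.
have hq : 2 * 4 ^ s * (cu (coefs_of (2 * s + 2) s) k + cv (coefs_of (2 * s + 2) s) k) <=
  2 ^ (p' + 2 * s + 1).
  by rewrite addn1 expnS expnD expnM [2 ^ p' * _]mulnC mulnA leq_mul2l hp' orbT.
(* Since [quad] is quadratic, [b0 = 2 * l + c] is large enough, so the phases cost only about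
   [2 * l] bits per column. *)
apply: leq_trans (@card_leq_pow2 n s P s1 nosh P0 k p (p' + 2 * s + 1) nk hp hq (2 * l + c) _) _.
  have e : 2 ^ (2 * l + c) = 2 ^ l * 2 ^ l * 2 ^ c by rewrite -!expnD; congr (2 ^ _); lia.
  rewrite e; have := ltn_expl l (isT : 1 < 2); have := hc; move: pl; rewrite -!mulnn.
  move: (2 ^ l) (2 ^ c) (s * s) => L Q S pL h lL.
  have z : p + (2 * l + c) + 2 <= L * (c + 5) by nia.
  have zz := leq_mul z z; apply: leq_trans (_ : S * (6 * (L * (c + 5) * (L * (c + 5)))) <= _).
    by rewrite leq_mul2l; apply/orP; right; move: z zz; move: (p + _ + _) => w z zz; nia.
  have := leq_mul h (leqnn (L * L)); nia.
by rewrite leq_exp2l // leq_mul2l; apply/orP; right; rewrite -/l; lia.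
Qed.

Lemma alphaP n : 0 < alpha n /\ alphad (alpha n) n <= 3.
Proof. by rewrite /alpha; case: ex_minnP => k /andP[]. Qed.

Lemma leq_ack_alpha n : n <= ack (alpha n).-1 3.
Proof.
have [a0 a3] := alphaP n; apply: alphad_leP; by rewrite prednK.
Qed.

Lemma alpha_unbounded K : exists N, forall n, N <= n -> K < alpha n.
Proof.
exists (\sum_(k < K) ack k 3).+1 => n Nn; rewrite ltnNge; apply/negP => aK.
move: Nn; apply/negP; rewrite -leqNgt; apply: leq_trans (leq_ack_alpha n) _.
have [a0 _] := alphaP n.
have lt : (alpha n).-1 < K by rewrite prednK.
by rewrite (bigD1 (Ordinal lt)) //= leq_addr.
Qed.

Lemma alpha_ge2 n : 1 < alpha n -> n <= ack (alpha n - 2).+1 3.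
Proof. by move=> a1; have := leq_ack_alpha n; congr (_ <= ack _ _); lia. Qed.

Lemma r_vc3_bound : exists c, forall n, 1 < alpha n ->
  r_vc 3 n <= 2 ^ (n * (3 * up_log 2 (alpha n) + c)).
Proof.
have [c hc] := @r_vc_leq_pow2 4 isT; have [c4 h4] := coefs4_growth (2 * 4 + 2).
have [d hd] := linear_up_log 4.
pose p l := (2 * l + c4).+1.
exists (c + d + 2 * c4 + 20) => n a1; pose k := alpha n - 2; pose l := up_log 2 (alpha n).
have al : alpha n <= 2 ^ l by apply: up_logP.
have [x y u v] := h4 k.
(* The exponent 7 comes from [14 + 52 <= 2 ^ 7]. The logarithm of [p l] is later absorbed into a
   third copy of [l]. *)
apply: leq_trans (hc n k (p l) 7 (alpha_ge2 a1) isT _ _) _.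
- have -> : 2 ^ p l = 2 ^ c4 * (2 ^ l * 2 ^ l) + 2 ^ c4 * (2 ^ l * 2 ^ l).
    by rewrite addnn -mul2n -!expnD -expnS; congr (2 ^ _); rewrite /p; lia.
  have kl : k.+1 <= 2 ^ l by apply: leq_trans al; rewrite /k; lia.
  have cc := ltnW (ltn_pow2 c4); have L0 := expn_gt0 2 l; rewrite -mulnn in y.
  apply: leq_trans (leq_add x y) (leq_add _ _); last by rewrite !leq_mul.
  by rewrite leq_mul // (leq_trans kl) // leq_pmulr.
- by apply: leq_trans (leq_add u v) _.
by rewrite leq_exp2l // leq_mul2l; apply/orP; right; have := hd (p l); rewrite -/l /p; lia.
Qed.

(** The columns contribute [k] plus a logarithm and the rows two logarithms; [linear_up_log] bounds
    all logarithms by fractions of [k]. *)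
Lemma r_vc4_bound : exists c, forall n, 1 < alpha n -> r_vc 4 n <= 2 ^ (n * (2 * alpha n + c)).
Proof.
have [c hc] := @r_vc_leq_pow2 5 isT; have [c5 h5] := coefs5_growth (2 * 5 + 2).
have [d hd] := linear_up_log 12; have [d' hd'] := linear_up_log 6.
exists (c + 2 * d + d' + 20 * c5 + 40) => n a1; pose k := alpha n - 2; pose l := up_log 2 k.+1.
have kl : k.+1 <= 2 ^ l by apply: up_logP.
have cc := ltnW (ltn_pow2 c5).
pose p := (k + l + c5).+1.
have [x y u v] := h5 k.
apply: leq_trans (hc n k p (2 * l + c5).+1 (alpha_ge2 a1) isT _ _) _.
- have -> : 2 ^ p = 2 ^ c5 * 2 ^ l * 2 ^ k + 2 ^ c5 * 2 ^ l * 2 ^ k.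
    by rewrite addnn -mul2n -!expnD -expnS; congr (2 ^ _); rewrite /p; lia.
  apply: leq_trans (leq_add x y) (leq_add _ _); last by rewrite !leq_mul.
  by rewrite leq_mul // (leq_trans cc) // leq_pmulr // expn_gt0.
- have -> : 2 ^ (2 * l + c5).+1 = 2 ^ c5 * (2 ^ l * 2 ^ l) + 2 ^ c5 * (2 ^ l * 2 ^ l).
    by rewrite addnn -mul2n -!expnD -expnS; congr (2 ^ _); lia.
  rewrite -mulnn in v; apply: leq_trans (leq_add u v) (leq_add _ _); last by rewrite !leq_mul.
  by rewrite leq_mul // (leq_trans kl) // leq_pmulr // expn_gt0.
rewrite leq_exp2l // leq_mul2l; apply/orP; right.
have := hd k.+1; have := hd' p; rewrite -/l {3}/p; have : k <= alpha n by rewrite /k leq_subr.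
rewrite /p; move: (up_log 2 _) => q; lia.
Qed.


Lemma bin_leq_pow2 n t : 'C(n, t) <= 2 ^ n.
Proof.
elim: n t => [|n IH] [|t]; rewrite ?bin0 ?expn_gt0 //.
by rewrite binS expnS mul2n -addnn leq_add.
Qed.

Lemma pow2_bounds_sum e s k a b : a <= b -> pow2_bounds e s k a b ->
  cx (coefs_of e s) k + cy (coefs_of e s) k <= 2 ^ b.+1 /\
  cu (coefs_of e s) k + cv (coefs_of e s) k <= 2 ^ b.+1.
Proof.
move=> ab [x u y v]; have h : 2 ^ a <= 2 ^ b by rewrite leq_exp2l.
by rewrite expnS; split; lia.
Qed.

(** The columns and the rows contribute the same binomial exponent, hence the factor 2; the
    logarithm of the exponent is linear in [alpha n]. *)
Lemma r_vc_even_bound t : exists c, forall n, 1 < alpha n ->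
  r_vc (2 * t.+1 + 2) n <= 2 ^ (n * (2 * 'C(alpha n + c, t.+1) + 4 * alpha n + c)).
Proof.
have [_ [c0 h0]] := coefs_parity_growth (2 * t.*2.+4.+1 + 2) t.
have [c hc] := @r_vc_leq_pow2 t.*2.+4.+1 isT.
have -> : 2 * t.+1 + 2 = t.*2.+4 by lia.
exists (c + 2 * c0 + 10) => n a1; pose k := alpha n - 2; pose b := 'C(k + c0, t.+1) + k.
have [h1 h2] := pow2_bounds_sum (leq_addr _ _) (h0 k).
apply: leq_trans (hc n k b.+1 b.+1 (alpha_ge2 a1) isT h1 h2) _.
have lb : up_log 2 b.+1 <= k + c0 + 1.
  apply: up_log_min => //; rewrite addn1 expnS mul2n -addnn /b -addnS leq_add ?bin_leq_pow2 //.
  by apply: leq_trans (ltn_pow2 k) _; rewrite leq_exp2l // leq_addr.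
have : 'C(k + c0, t.+1) <= 'C(alpha n + (c + 2 * c0 + 10), t.+1) by apply: leq_bin2l; lia.
by rewrite leq_exp2l // leq_mul2l => le; apply/orP; right; move: lb; rewrite /b; lia.
Qed.

Lemma r_vc_odd_bound t : exists c, forall n, 1 < alpha n ->
  r_vc (2 * t + 3) n <=
    2 ^ (n * (2 * ('C(alpha n + c, t) * (up_log 2 (alpha n) + c)) + 6 * alpha n + c)).
Proof.
have [[c0 h0] _] := coefs_parity_growth (2 * t.*2.+4 + 2) t.
have [c hc] := @r_vc_leq_pow2 t.*2.+4 isT.
have -> : 2 * t + 3 = t.*2.+3 by lia.
exists (c + 4 * c0 + 10) => n a1; pose k := alpha n - 2; set l := up_log 2 (alpha n).
have kl : k <= 2 ^ l by apply: leq_trans (up_logP _ _); rewrite // /k leq_subr.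
pose b := 'C(k + c0, t) * (l + c0) + l.
have [h1 h2] := pow2_bounds_sum (leq_addr _ _) (h0 l k kl).
apply: leq_trans (hc n k b.+1 b.+1 (alpha_ge2 a1) isT h1 h2) _.
have lb : up_log 2 b.+1 <= k + l + 2 * c0 + 1.
  apply: up_log_min => //; rewrite addn1 expnS mul2n -addnn /b -addnS leq_add //.
    have -> : k + l + 2 * c0 = (k + c0) + (l + c0) by lia.
    by rewrite expnD leq_mul ?bin_leq_pow2 // ltnW // ltn_pow2.
  by apply: leq_trans (ltn_pow2 l) _; rewrite leq_exp2l //; lia.
have la : l <= alpha n by apply: up_log_min => //; apply: ltnW (ltn_pow2 _).
have : 'C(k + c0, t) * (l + c0) <= 'C(alpha n + (c + 4 * c0 + 10), t) * (l + (c + 4 * c0 + 10)).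
  by apply: leq_mul; [apply: leq_bin2l|]; lia.
by rewrite leq_exp2l // leq_mul2l => le; apply/orP; right; move: lb; rewrite /b; lia.
Qed.

Lemma r_vc3_alpha : exists K, forall n, K < alpha n -> r_vc 3 n <= alpha n ^ (4 * n).
Proof.
have [c hc] := r_vc3_bound; exists (2 ^ (c + 3)) => n Ka.
have a1 : 1 < alpha n by apply: leq_ltn_trans Ka; rewrite expn_gt0.
have [n0|n0] := posnP n; first by apply: leq_trans (hc n a1) _; rewrite n0.
apply: leq_trans (hc n a1) _; rewrite [n * _]mulnC !expnM leq_exp2r //.
have := up_log_gtn (isT : 1 < 2) a1; have : 0 < up_log 2 (alpha n) by rewrite up_log_gt0.
case: (up_log 2 (alpha n)) => // l _; rewrite -pred_Sn => la.
have -> : 3 * l.+1 + c = l + l + l + (c + 3) by lia.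
(* Three factors [2 ^ l] and the constant [2 ^ (c + 3)] are each below [alpha n]. *)
rewrite !(expnD 2) -(expnD 2 c) (expnD _ 2 2) -!mulnn -!mulnA.
by rewrite !leq_mul // ltnW.
Qed.

Lemma expn_addn_leq c t : exists d, forall m, 0 < m -> (m + c) ^ t.+1 <= m ^ t.+1 + d * m ^ t.
Proof.
elim: t => [|t [d IH]]; first by exists c => m _; rewrite !expn1 expn0 muln1.
exists (d + c + c * d) => m m0; have := leq_mul (leqnn (m + c)) (IH m m0).
rewrite -expnS => h; apply: leq_trans h _; rewrite (expnS m t.+1) (expnS m t).
move: (m ^ t) => X; have : c * (d * X) <= c * (d * (m * X)).
  by rewrite !leq_mul2l leq_pmull ?orbT.
nia.
Qed.

Lemma fact_bin_leq c t : exists d, forall m, 0 < m ->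
  'C(m + c, t.+1) * t.+1`! <= m ^ t.+1 + d * m ^ t.
Proof.
have [d hd] := expn_addn_leq c t; exists d => m m0; apply: leq_trans (hd m m0).
rewrite bin_ffact ffact_prod -[X in _ ^ X](card_ord t.+1) -prod_nat_const.
by apply: leq_prod => i _; apply: leq_subr.
Qed.

(** * Asymptotics *)

From mathcomp Require Import all_order all_algebra all_classical all_reals all_analysis.
From mathcomp Require Import lra ring.
Import Order.TTheory GRing.Theory Num.Theory numFieldNormedType.Exports.
Unset Implicit Arguments.
Set Strict Implicit.
Set Printing Implicit Defensive.
Local Open Scope classical_set_scope.
Local Open Scope ring_scope.

Lemma near_alpha (K : nat) : \forall n \near \oo, (K < alpha n)%N.
Proof. by have [N hN] := alpha_unbounded K; near=> n; apply: hN; near: n; apply: nbhs_infty_ge.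
Unshelve. all: by end_near. Qed.

Section Real.
Variable R : realType.
Implicit Types (n m t : nat) (x : R).

Lemma leq_pow2_powR n m e x : (m <= 2 ^ (n * e))%N -> e%:R <= x ->
  m%:R <= 2 `^ (n%:R * x).
Proof.
move=> me ex; apply: (@le_trans _ _ (2 `^ (n * e)%:R)).
  by rewrite powR_mulrn // -natrX ler_nat.
by apply: ler_powR; [rewrite ler1n | rewrite natrM ler_wpM2l].
Qed.

Lemma ln2_gt0 : 0 < ln 2 :> R. Proof. by rewrite ln_gt0 // ltr1n. Qed.

Lemma leq_log2 k m : (2 ^ k <= m)%N -> k%:R <= log2 (m%:R : R).
Proof.
move=> km; rewrite ler_pdivlMr ?ln2_gt0 // mulr_natl -lnXn // ler_ln ?posrE //.
  by rewrite -natrX ler_nat.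
by rewrite ltr0n (leq_trans _ km) // expn_gt0.
Qed.

Lemma log2_leq k m : (0 < m)%N -> (m <= 2 ^ k)%N -> log2 (m%:R : R) <= k%:R.
Proof.
move=> m0 mk; rewrite ler_pdivrMr ?ln2_gt0 // mulr_natl -lnXn // ler_ln ?posrE //.
  by rewrite -natrX ler_nat.
by rewrite ltr0n.
Qed.

Lemma log2_ge0 m : (0 < m)%N -> 0 <= log2 (m%:R : R).
Proof. by move=> m0; apply: (@leq_log2 0). Qed.

Lemma bigO_scale (f : nat -> R) (c : nat) : (fun n => c%:R * f n) =O_\oo f.
Proof.
apply/eqO_exP; exists (c%:R + 1); first by rewrite ltr_wpDl.
by near=> n; rewrite normrM normr_nat ler_wpM2r // lerDl.
Unshelve. all: by end_near. Qed.

Lemma bin_leq c t : exists d : nat, forall m, (0 < m)%N ->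
  'C(m + c, t.+1)%:R <= (m%:R : R) ^+ t.+1 / (t.+1)`!%:R + d%:R * m%:R ^+ t.
Proof.
have [d hd] := fact_bin_leq c t; exists d => m m0; have := hd m m0.
rewrite -(ler_nat R) natrD [('C(_, _) * _)%:R]natrM [(d * _)%:R]natrM !natrX => h.
have f1 : 1 <= (t.+1)`!%:R :> R by rewrite ler1n fact_gt0.
have f0 : 0 < (t.+1)`!%:R :> R by apply: lt_le_trans f1.
rewrite -(ler_pM2r f0); apply: le_trans h _.
rewrite mulrDl divfK ?gt_eqF // lerD2l ler_peMr // mulr_ge0 // exprn_ge0 //.
Qed.

End Real.

Theorem theorem1p1 (R : realType) :
  let a : nat -> R := fun n => (alpha n)%:R in
  [/\ exists2 e : nat -> R, e =o_\oo (fun _ : nat => 1 : R) &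
        \forall n \near \oo,
          (r_vc 3 n)%:R <= a n `^ ((4 + e n) * n%:R),
      exists2 g : nat -> R, g =O_\oo (fun _ : nat => 1 : R) &
        \forall n \near \oo,
          (r_vc 4 n)%:R <= 2 `^ (n%:R * (2 * a n + 3 * log2 (a n) + g n)),
      forall t : nat, (2 <= t)%N ->
        exists2 g : nat -> R, g =O_\oo (fun n : nat => a n ^+ (t - 1)) &
          \forall n \near \oo,
            (r_vc (2 * t + 2) n)%:R <=
              2 `^ (n%:R * (2 / (t`!)%:R * a n ^+ t + g n))
    & forall t : nat, (1 <= t)%N ->
        exists2 g : nat -> R, g =O_\oo (fun n : nat => a n ^+ t) &
          \forall n \near \oo,
            (r_vc (2 * t + 3) n)%:R <=
              2 `^ (n%:R * (2 / (t`!)%:R * a n ^+ t * log2 (a n) + g n))].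
Proof.
move=> a; split.
(* The exponent [4 * n] is reached without any error term. *)
- have [K hK] := r_vc3_alpha; exists (fun=> 0).
    by apply/eqoP => eps eps0; near=> n; rewrite normr0 normr1 mulr1 ltW.
  near=> n; rewrite addr0 -natrM powR_mulrn ?ler0n // -natrX ler_nat; apply: hK.
  by near: n; apply: near_alpha.
- have [c hc] := r_vc4_bound; exists (fun n => c%:R * 1); first exact: bigO_scale.
  near=> n; have a1 : (1 < alpha n)%N by near: n; apply: near_alpha.
  apply: leq_pow2_powR (hc n a1) _; rewrite mulr1 natrD natrM lerD2r lerDl.
  by rewrite mulr_ge0 // log2_ge0 // ltnW.
- move=> [|[|t]] // _; have [c hc] := r_vc_even_bound t.+1.
  have [d hd] := bin_leq R c t.+1.
  exists (fun n => (2 * d + 4 + c)%:R * a n ^+ t.+1);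
    first by rewrite subSS subn0; apply: bigO_scale.
  near=> n; have a1 : (1 < alpha n)%N by near: n; apply: near_alpha.
  apply: leq_pow2_powR (hc n a1) _; have := hd _ (ltnW a1); rewrite -/(a n).
  have A1 : 1 <= a n by rewrite ler1n ltnW.
  (* The linear term fits into the error because [t - 1], here [t.+1], is at least 1. *)
  have h1 : a n <= a n ^+ t.+1 by rewrite ler_eXnr.
  have h2 : 1 <= a n ^+ t.+1 by rewrite exprn_ege1.
  have -> : (2 * 'C(alpha n + c, t.+2) + 4 * alpha n + c)%:R =
      2 * 'C(alpha n + c, t.+2)%:R + 4 * a n + c%:R :> R.
    by rewrite 2!natrD (natrM _ 2) (natrM _ 4).
  have -> : (2 * d + 4 + c)%:R = 2 * d%:R + 4 + c%:R :> R by rewrite 2!natrD (natrM _ 2).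
  move=> h.
  have h3 : c%:R <= c%:R * a n ^+ t.+1 by rewrite ler_peMr.
  by rewrite -[2 / _ * _]mulrA [_^-1 * _]mulrC; lra.
move=> [|t] // _; have [c hc] := r_vc_odd_bound t.+1.
have [d hd] := bin_leq R c t.
exists (fun n => (2 * (1 + c) + 2 * d + 2 * d * (1 + c) + 6 + c)%:R * a n ^+ t.+1).
  exact: bigO_scale.
near=> n; have a1 : (1 < alpha n)%N by near: n; apply: near_alpha.
apply: leq_pow2_powR (hc n a1) _; have := hd _ (ltnW a1); rewrite -/(a n).
have A1 : 1 <= a n by rewrite ler1n ltnW.
have lg0 : 0 <= log2 (a n) by apply: log2_ge0; apply: ltnW.
have lgA : log2 (a n) <= a n.
  by apply: log2_leq; [exact: ltnW | exact: ltnW (ltn_pow2 _)].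
have ll : (up_log 2 (alpha n))%:R <= log2 (a n) + 1.
  have := up_log_gtn (isT : (1 < 2)%N) a1; have : (0 < up_log 2 (alpha n))%N by rewrite up_log_gt0.
  case: (up_log 2 (alpha n)) => // l _ /ltnW; rewrite -pred_Sn => /leq_log2 - /(_ R).
  by rewrite -natr1 lerD2r.
have Y0 : 0 <= a n ^+ t by rewrite exprn_ge0.
have YA : a n ^+ t * a n = a n ^+ t.+1 by rewrite exprSr.
have f1 : 1 <= (t.+1)`!%:R :> R by rewrite ler1n fact_gt0.
have X0 : 0 <= a n ^+ t.+1 by rewrite exprn_ge0.
pose X := a n ^+ t.+1 / (t.+1)`!%:R.
have XA : X <= a n ^+ t.+1 by rewrite ler_pdivrMr ?(lt_le_trans _ f1) // ler_peMr.
have Xge0 : 0 <= X by rewrite divr_ge0.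
have Yle : a n ^+ t <= a n ^+ t.+1 by rewrite -YA ler_peMr.
have Ylg : a n ^+ t * log2 (a n) <= a n ^+ t.+1 by rewrite -YA ler_wpM2l.
have h1 : a n <= a n ^+ t.+1 by rewrite ler_eXnr.
have h2 : 1 <= a n ^+ t.+1 by rewrite exprn_ege1.
rewrite -/X => h; set l := (up_log 2 _)%:R in ll.
have -> : (2 * ('C(alpha n + c, t.+1) * (up_log 2 (alpha n) + c)) + 6 * alpha n + c)%:R =
    2 * ('C(alpha n + c, t.+1)%:R * (l + c%:R)) + 6 * a n + c%:R :> R.
  by rewrite 2!natrD (natrM _ 2) (natrM _ 6) (natrM _ 'C(_, _)) (natrD _ (up_log _ _)).
have -> : (2 * (1 + c) + 2 * d + 2 * d * (1 + c) + 6 + c)%:R =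
    2 * (1 + c%:R) + 2 * d%:R + 2 * d%:R * (1 + c%:R) + 6 + c%:R :> R.
  by rewrite 4!natrD (natrM _ (2 * d)) !(natrM _ 2) (natrD _ 1).
have -> : 2 / (t.+1)`!%:R * a n ^+ t.+1 * log2 (a n) = 2 * X * log2 (a n) by rewrite /X; ring.
have c0 : 0 <= c%:R :> R by []; have d0 : 0 <= d%:R :> R by [].
(* Of the expanded product only [X * log2 (a n)] is a main term; the others are at most multiples of
   [a n ^+ t.+1], as [log2 (a n) <= a n]. *)
have hC : ('C(alpha n + c, t.+1))%:R * (l + c%:R) <= (X + d%:R * a n ^+ t) *
  (log2 (a n) + 1 + c%:R).
  by apply: ler_pM => //; [rewrite addr_ge0 | rewrite lerD2r].
have e1 : X * c%:R <= a n ^+ t.+1 * c%:R by rewrite ler_wpM2r.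
have e2 : d%:R * (a n ^+ t * log2 (a n)) <= d%:R * a n ^+ t.+1 by rewrite ler_wpM2l.
have e3 : d%:R * a n ^+ t <= d%:R * a n ^+ t.+1 by rewrite ler_wpM2l.
have e4 : d%:R * a n ^+ t * c%:R <= d%:R * a n ^+ t.+1 * c%:R by rewrite ler_wpM2r.
have e5 : c%:R <= c%:R * a n ^+ t.+1 by rewrite ler_peMr.
lra.
Unshelve. all: by end_near.
Qed.
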